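(* Let $\kappa_0,\kappa_1,\kappa_2>0$ and $d^\infty>0$, and consider the planar system $$\dot x=v,\qquad \dot v=-\kappa_0\Big(\frac{x}{|x|}\Big)^2v-\kappa_1\Big(\frac{x}{|x|}\Big)^2v-\kappa_2\big(|x|-d^\infty\big)\frac{x}{|x|},$$ i.e. $\ddot x=-(\kappa_0+\kappa_1)\dot x-\kappa_2x+\kappa_2d^\infty$ for $x>0$ and $\ddot x=-(\kappa_0+\kappa_1)\dot x-\kappa_2x-\kappa_2d^\infty$ for $x<0$, with initial data $(x(0),v(0))=(x^0,v^0)\ne(0,0)$. Then: (1) the Cauchy problem admits a unique global (i.e. on $[0,\infty)$) Filippov solution $(x,v)$ if and only if the solution satisfies $(x(t),v(t))\ne(0,0)$ for all $t\ge0$; otherwise (if the solution reaches $(0,0)$ at some time) there are infinitely many Filippov solutions; (2) if $(x,v)$ is a Filippov solution with $(x(t),v(t))\ne(0,0)$ for all $t\ge0$, then $\lim_{t\to\infty}|x(t)|=d^\infty$.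
   Context: This system is the relative dynamics $x=x_1-x_2$, $v=v_1-v_2$ of the two-particle Cucker–Smale model with bonding force on the real line with communication weight $\psi\equiv1$ and desired distance $d^\infty=d^\infty_{12}$. Filippov solutions: for a possibly discontinuous vector field $Z:\mathbb{R}^n\to\mathbb{R}^n$, define the set-valued map $F[Z](z):=\bigcap_{\delta>0}\bigcap_{|S|=0}\overline{\mathrm{co}}\{Z(B_\delta(z)\setminus S)\}$, where $\overline{\mathrm{co}}$ is the closed convex hull and the second intersection is over all Lebesgue-null sets $S$. An absolutely continuous $z:[0,T]\to\mathbb{R}^n$ (or on $[0,\infty)$, absolutely continuous on each compact subinterval) is a Filippov solution of $\dot z=Z(z)$ if $\dot z(t)\in F[Z](z(t))$ for almost every $t$. Here $n=2$, $z=(x,v)$, and $Z$ is the right-hand side above (defined arbitrarily on the null set $\{x=0\}$). *)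

(* Defs.v *)
From HB Require Import structures.
From mathcomp Require Import all_boot all_order all_algebra.
From mathcomp Require Import all_classical all_reals all_analysis.
Set Implicit Arguments. Unset Strict Implicit. Unset Printing Implicit Defensive.
Import Order.TTheory GRing.Theory Num.Theory.
Import numFieldNormedType.Exports.
Local Open Scope classical_set_scope.
Local Open Scope ring_scope.

Section Filippov.
Variable R : realType.

Definition null2 (S : set (R * R)) : Prop :=
  ((@lebesgue_measure R) \x (@lebesgue_measure R))%E.-negligible S.

Definition convex2 (C : set (R * R)) : Prop :=
  forall p q, C p -> C q -> forall l : R, 0 <= l <= 1 ->
    C (l * p.1 + (1 - l) * q.1, l * p.2 + (1 - l) * q.2).

Definition cl_conv_hull (A : set (R * R)) : set (R * R) :=
  \bigcap_(C in [set C | closed C /\ convex2 C /\ A `<=` C]) C.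

Definition filippov_map (Z : R * R -> R * R) (p : R * R) : set (R * R) :=
  \bigcap_(delta in [set delta : R | 0 < delta])
    \bigcap_(S in null2) cl_conv_hull (Z @` (ball p delta `\` S)).

Definition abs_cont_on (f : R -> R) (a b : R) : Prop :=
  forall e : R, 0 < e -> exists2 dl : R, 0 < dl &
    forall (n : nat) (a' b' : nat -> R),
      (forall i, (i < n)%N -> a <= a' i /\ a' i <= b' i /\ b' i <= b) ->
      (forall i, (i.+1 < n)%N -> b' i <= a' i.+1) ->
      \sum_(i < n) (b' i - a' i) < dl ->
      \sum_(i < n) `|f (b' i) - f (a' i)| < e.

(* z = (x, v) : [0, oo) -> R^2 is a global Filippov solution of z' = Z(z):
   absolutely continuous on every compact [0,T] (componentwise), and for
   almost every t >= 0, z is differentiable at t with z'(t) in F[Z](z(t)).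
   (Values of z at t < 0 are irrelevant.) *)
Definition filippov_sol (Z : R * R -> R * R) (z : R -> R * R) : Prop :=
  (forall T : R, 0 <= T ->
     abs_cont_on (fun t => (z t).1) 0 T /\ abs_cont_on (fun t => (z t).2) 0 T) /\
  exists N : set R, (@lebesgue_measure R).-negligible N /\
    forall t : R, 0 <= t -> ~ N t ->
      derivable (fun s => (z s).1) t 1 /\ derivable (fun s => (z s).2) t 1 /\
      filippov_map Z (z t) (derive1 (fun s => (z s).1) t, derive1 (fun s => (z s).2) t).

(* restriction of a trajectory to [0, oo) (extended by z 0 for t < 0),
   used to count solutions as functions on [0, oo) *)
Definition restr0 (z : R -> R * R) : R -> R * R :=
  fun t => if 0 <= t then z t else z 0.

(* The vector field of the relative two-particle CS model with bonding force;
   on the null set {x = 0} it takes the arbitrary values Z0 v. *)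
Definition csb_field (k0 k1 k2 dinf : R) (Z0 : R -> R * R) (p : R * R) : R * R :=
  let x := p.1 in let v := p.2 in
  if x == 0 then Z0 v else
  (v, - k0 * (x / `|x|) ^+ 2 * v - k1 * (x / `|x|) ^+ 2 * v
      - k2 * (`|x| - dinf) * (x / `|x|)).

End Filippov.

(* Main.v *)
Require Import Defs.
From HB Require Import structures.
From mathcomp Require Import all_boot all_order all_algebra.
From mathcomp Require Import all_classical all_reals all_analysis.
From mathcomp Require Import measurable_realfun ring lra.
Set Implicit Arguments. Unset Strict Implicit. Unset Printing Implicit Defensive.
Import Order.TTheory GRing.Theory Num.Theory.
Import numFieldNormedType.Exports.
Local Open Scope classical_set_scope.
Local Open Scope ring_scope.

(* Write k = k0 + k1. On each side s = +1, -1 of the axis x = 0 the system is the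
   damped oscillator y' = v, v' = - k v - k2 y for y = x - s d, and
   v^2 + k2 y^2 decreases along it. Every element of the Filippov set has first
   component v, so a solution at (0, v) with v <> 0 crosses the axis
   transversally: after any time at which it is not at the origin, it stays for a
   while on a side determined by its current state. Applied to the difference of
   two solutions, the same quadratic form then gives uniqueness as long as the
   origin is avoided. At the origin, where (0, 0) belongs to the Filippov set, a
   solution may wait for an arbitrary time before leaving.

   For the asymptotics, E = v^2 + k2 (|x| - d)^2 is nonincreasing, and v -> 0
   since v is Lipschitz. If E had a positive limit, then | |x| - d | would be
   bounded below, so v' would eventually have a definite size and sign as long as
   x does not change sign; and after a zero of x at which v <> 0, x would keep
   its new sign while |v| increases. Both contradict v -> 0. *)

(** * Induction on real intervals and absolute continuity *)

(** Otherwise the set of failures has an infimum. The first hypothesis gives [P] there, and the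
    second carries [P] past it, so it cannot be the infimum. *)
Lemma real_ind (R : realType) (a : R) (P : R -> Prop) :
  (forall c, a <= c -> (forall s, a <= s -> s < c -> P s) -> P c) ->
  (forall c, a <= c -> P c ->
     exists2 h : R, 0 < h & forall s, c < s -> s <= c + h -> P s) ->
  forall t, a <= t -> P t.
Proof.
move=> Pl Pr t at_; apply: contrapT => Pt.
pose B := [set s | a <= s /\ ~ P s].
have Bt : B t by [].
have lB : has_lbound B by exists a => s [].
have infB : has_inf B by split => //; exists t.
have ac : a <= inf B by apply: lb_le_inf => [|s []//]; exists t.
have below s : a <= s -> s < inf B -> P s.
  move=> as_ sB; apply: contrapT => Ps; move: sB; apply/negP; rewrite -leNgt.
  by apply: ge_inf => //.
have [h h0 Ph] := Pr _ ac (Pl _ ac below).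
have [s [as_ Ps] sh] := @inf_adherent R B h h0 infB.
have Bs : inf B <= s by apply: ge_inf.
apply: Ps; move: Bs; rewrite le_eqVlt => /orP[/eqP<-|Bs].
  exact: Pl.
by apply: Ph => //; exact: ltW.
Qed.

(** Induction in the style of Cousin's lemma: each tag [c] has its own gauge [h], and [G] only has
    to pass over intervals that contain [c] and stay within [h] of it. *)
Lemma cousin_ind (R : realType) (a b : R) (G : R -> Prop) : a <= b -> G a ->
  (forall c, a <= c -> c <= b -> exists2 h : R, 0 < h &
     forall s s', a <= s -> s <= c -> c <= s' -> s' <= b ->
       c - h < s -> s' < c + h -> G s -> G s') ->
  G b.
Proof.
move=> ab Ga Gstep.
suff H : forall t, a <= t -> t <= b -> G t by exact: H.
apply: real_ind => [c ac IH cb|c ac Gc].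
  move: ac; rewrite le_eqVlt => /orP[/eqP<-//|ac].
  have [h h0 st] := Gstep c (ltW ac) cb.
  (* The point [Num.max a (c - h / 2)] lies in [[a, c)] within [h] of [c], so one step at the tag
     [c] leads from it to [c]. *)
  have m1 : a <= Num.max a (c - h / 2) by rewrite le_max lexx.
  have m2 : Num.max a (c - h / 2) < c by rewrite gt_max ac/= ltrBlDr ltrDl divr_gt0.
  apply: (st (Num.max a (c - h / 2))) => //.
  - exact: ltW.
  - by rewrite lt_max; apply/orP; right; lra.
  - lra.
  - by apply: IH => //; apply: ltW; apply: (lt_le_trans m2).
have [cb|bc] := leP c b; last first.
  by exists 1 => // s cs _ sb; move: (lt_trans bc cs); rewrite ltNge sb.
have [h h0 st] := Gstep c ac cb.
exists (h / 2); first by rewrite divr_gt0.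
move=> s cs sh sb; apply: (st c) => //; try lra.
- exact: Gc.
Qed.

(** * Absolutely continuous functions: algebra, reparametrisation, concatenation *)

Section abs_cont.
Variable R : realType.
Implicit Types (f g : R -> R) (a b : R).

Lemma abs_contS f a b a1 b1 : a <= a1 -> b1 <= b ->
  abs_cont_on f a b -> abs_cont_on f a1 b1.
Proof.
move=> aa bb acf e e0; have [dl dl0 H] := acf e e0.
exists dl => // n a' b' h1 h2 h3; apply: H => // i ni.
have [? [? ?]] := h1 i ni; lra.
Qed.

Lemma eq_abs_cont f g a b : (forall t, a <= t -> t <= b -> f t = g t) ->
  abs_cont_on f a b -> abs_cont_on g a b.
Proof.
move=> fg acf e e0; have [dl dl0 H] := acf e e0.
exists dl => // n a' b' h1 h2 h3.
rewrite [ltLHS](_ : _ = \sum_(i < n) `|f (b' i) - f (a' i)|); first exact: H.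
by apply: eq_bigr => i _; have [? [? ?]] := h1 i (ltn_ord i); rewrite !fg//; lra.
Qed.

Lemma abs_cont_dist f a b e : abs_cont_on f a b -> 0 < e ->
  exists2 dl : R, 0 < dl & forall s t, a <= s -> s <= b -> a <= t -> t <= b ->
    `|t - s| < dl -> `|f t - f s| < e.
Proof.
move=> acf e0; have [dl dl0 H] := acf e e0; exists dl => // s t as_ sb at_ tb.
wlog st : s t as_ sb at_ tb / s <= t => [hw|].
  have [st|/ltW ts] := leP s t; first exact: hw.
  by rewrite distrC (distrC (f t)); exact: hw.
rewrite ger0_norm ?subr_ge0// => tsd.
have := H 1%N (fun=> s) (fun=> t); rewrite !big_ord1; apply => //.
Qed.

Lemma abs_contD f g a b : abs_cont_on f a b -> abs_cont_on g a b ->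
  abs_cont_on (fun t => f t + g t) a b.
Proof.
move=> acf acg e e0.
have [d1 d10 H1] := acf (e / 2) ltac:(lra).
have [d2 d20 H2] := acg (e / 2) ltac:(lra).
exists (Num.min d1 d2); first by rewrite lt_min d10.
move=> n a' b' h1 h2; rewrite lt_min => /andP[h3 h4].
have := H1 n a' b' h1 h2 h3; have := H2 n a' b' h1 h2 h4 => l2 l1.
apply: (@le_lt_trans _ _ (\sum_(i < n) (`|f (b' i) - f (a' i)| + `|g (b' i) - g (a' i)|))).
  by apply: ler_sum => i _; rewrite opprD addrACA ler_normD.
rewrite big_split/=; lra.
Qed.

Lemma abs_contM f g a b M : (forall t, a <= t -> t <= b -> `|f t| <= M) ->
  (forall t, a <= t -> t <= b -> `|g t| <= M) ->
  abs_cont_on f a b -> abs_cont_on g a b -> abs_cont_on (fun t => f t * g t) a b.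
Proof.
move=> fM gM acf acg e e0.
pose L := `|M| + 1; have L0 : 0 < L by rewrite /L; have := normr_ge0 M; lra.
have ML : M <= L by rewrite /L; have := ler_norm M; lra.
have [d1 d10 H1] := acf (e / (2 * L)) ltac:(by rewrite divr_gt0// mulr_gt0).
have [d2 d20 H2] := acg (e / (2 * L)) ltac:(by rewrite divr_gt0// mulr_gt0).
exists (Num.min d1 d2); first by rewrite lt_min d10.
move=> n a' b' h1 h2; rewrite lt_min => /andP[h3 h4].
have := H1 n a' b' h1 h2 h3; have := H2 n a' b' h1 h2 h4 => l2 l1.
apply: (@le_lt_trans _ _ (\sum_(i < n) (L * `|f (b' i) - f (a' i)| + L * `|g (b' i) - g (a' i)|))).
  apply: ler_sum => i _; have [? [? ?]] := h1 i (ltn_ord i).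
  have -> : f (b' i) * g (b' i) - f (a' i) * g (a' i) =
    g (b' i) * (f (b' i) - f (a' i)) + f (a' i) * (g (b' i) - g (a' i)) by ring.
  rewrite (le_trans (ler_normD _ _))// !normrM lerD// ler_wpM2r//.
    by apply: le_trans ML; apply: gM => //; lra.
  by apply: le_trans ML; apply: fM => //; lra.
rewrite big_split/= -!mulr_sumr.
have -> : e = L * (e / (2 * L)) + L * (e / (2 * L)) by field; apply/lt0r_neq0.
by rewrite ltrD// ltr_pM2l.
Qed.

Lemma abs_cont_lip f a b L : (forall s t, a <= s -> s <= t -> t <= b ->
    `|f t - f s| <= L * (t - s)) -> abs_cont_on f a b.
Proof.
move=> lip e e0; pose K := `|L| + 1.
have K0 : 0 < K by rewrite /K; have := normr_ge0 L; lra.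
have LK : L <= K by rewrite /K; have := ler_norm L; lra.
exists (e / K); first by rewrite divr_gt0.
move=> n a' b' h1 _ h3.
apply: (@le_lt_trans _ _ (K * \sum_(i < n) (b' i - a' i))); last first.
  by rewrite mulrC -ltr_pdivlMr.
rewrite mulr_sumr; apply: ler_sum => i _; have [? [? ?]] := h1 i (ltn_ord i).
apply: (le_trans (lip _ _ _ _ _)) => //.
by rewrite ler_wpM2r// subr_ge0.
Qed.

Lemma abs_cont_cst (c : R) a b : abs_cont_on (fun=> c) a b.
Proof. by apply: (@abs_cont_lip _ _ _ 0) => s t _ _ _; rewrite subrr normr0 mul0r. Qed.

Lemma abs_contZ (c : R) f a b : abs_cont_on f a b -> abs_cont_on (fun t => c * f t) a b.
Proof.
move=> acf e e0; pose K := `|c| + 1.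
have K0 : 0 < K by rewrite /K; have := normr_ge0 c; lra.
have [dl dl0 H] := acf (e / K) ltac:(by rewrite divr_gt0).
exists dl => // n a' b' h1 h2 h3; have := H n a' b' h1 h2 h3.
rewrite ltr_pdivlMr//; apply: le_lt_trans.
rewrite mulr_suml; apply: ler_sum => i _.
by rewrite -mulrBr normrM mulrC ler_wpM2l// /K; lra.
Qed.

(** A nondecreasing map that does not expand distances sends an ordered family of intervals to an
    ordered family of no greater total length. It is meant for truncations such as
    [t -> min t b]. *)
Lemma abs_cont_comp f (h : R -> R) a b a1 b1 :
  (forall s t, a <= s -> s <= t -> t <= b ->
     a1 <= h s /\ h s <= h t /\ h t <= b1 /\ h t - h s <= t - s) ->
  abs_cont_on f a1 b1 -> abs_cont_on (fun t => f (h t)) a b.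
Proof.
move=> hh acf e e0; have [dl dl0 H] := acf e e0.
exists dl => // n a' b' h1 h2 h3; apply: (H n (h \o a') (h \o b')) => /=.
- move=> i ni; have [p1 [p2 p3]] := h1 i ni.
  by have [? [? [? ?]]] := hh _ _ p1 p2 p3; lra.
- move=> i ni; have [p1 [p2 p3]] := h1 i (ltnW ni).
  have [p4 [p5 p6]] := h1 _ ni.
  have [] := hh (b' i) (a' i.+1); [lra|exact: h2|lra|].
  by move=> _ [].
- apply: le_lt_trans h3; apply: ler_sum => i _.
  have [p1 [p2 p3]] := h1 i (ltn_ord i).
  by have [_ [_ []]] := hh _ _ p1 p2 p3.
Qed.

(** Writing [f t = f (min t b) + f (max t b) - f b] avoids cutting a family of intervals at [b]. *)
Lemma abs_cont_cat f a b c : a <= b -> b <= c ->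
  abs_cont_on f a b -> abs_cont_on f b c -> abs_cont_on f a c.
Proof.
move=> ab bc f1 f2.
apply: (@eq_abs_cont (fun t => f (Num.min t b) + f (Num.max t b) + (- f b))).
  by move=> t _ _; case: (leP t b) => _; ring.
apply: abs_contD (abs_cont_cst _ _ _); apply: abs_contD.
  apply: abs_cont_comp f1 => s t ? ? ?; rewrite !minElt.
  by case: ifP => sb; case: ifP => tb; move: sb tb => /= sb tb; repeat split; lra.
apply: abs_cont_comp f2 => s t ? ? ?; rewrite !maxElt.
by case: ifP => sb; case: ifP => tb; move: sb tb => /= sb tb; repeat split; lra.
Qed.

End abs_cont.

(** * Monotonicity from the sign of the derivative almost everywhere *)

(** Splitting the increment at [c] bounds it over every short interval containing [c], which is the
    kind of interval that [cousin_ind] asks about. *)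
Lemma is_derive_straddle (R : realType) (g : R -> R) (c D e : R) : is_derive c 1 g D ->
  D <= 0 -> 0 < e -> exists2 h : R, 0 < h & forall s s', s <= c -> c <= s' ->
    c - h < s -> s' < c + h -> g s' - g s <= e * (s' - s).
Proof.
move=> [dg eD] D0 e0.
have : (fun h => h^-1 *: ((g \o shift c) (h *: (1:R)) - g c)) @ 0^' --> D.
  by rewrite -eD; exact: dg.
move=> /cvgrPdist_lt/(_ _ e0)/nbhs_ballP[h/= h0 Hh]; exists h => // s s' sc cs' hs hs'.
have key u : u != c -> `|u - c| < h -> `|(u - c)^-1 * (g u - g c) - D| < e.
  move=> uc uh; rewrite distrC; have := Hh (u - c); rewrite /= /shift/=.
  rewrite /GRing.scale/= mulr1 subrK; apply; last by rewrite subr_eq0.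
  by rewrite /ball/= sub0r normrN.
have up : g s' - g c <= e * (s' - c).
  move: cs'; rewrite le_eqVlt => /orP[/eqP<-|cs']; first by lra.
  have := key s' ltac:(by rewrite gt_eqF) ltac:(by rewrite gtr0_norm ?subr_gt0//; lra).
  rewrite ltr_norml => /andP[_ H].
  have : (s' - c)^-1 * (g s' - g c) <= e by lra.
  by rewrite mulrC ler_pdivrMr ?subr_gt0.
have dn : g c - g s <= e * (c - s).
  move: sc; rewrite le_eqVlt => /orP[/eqP->|sc]; first by lra.
  have := key s ltac:(by rewrite lt_eqF) ltac:(by rewrite ltr0_norm ?subr_lt0//; lra).
  rewrite ltr_norml => /andP[_ H].
  have : (s - c)^-1 * (g s - g c) <= e by lra.
  rewrite -mulrNN -invrN !opprB mulrC ler_pdivrMr ?subr_gt0//.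
lra.
Qed.

Lemma negligible_set1 (R : realType) (a : R) : (@lebesgue_measure R).-negligible [set a].
Proof. by exists [set a]; split => //; exact: lebesgue_measure_set1. Qed.

Lemma negligible_open_cover (R : realType) (N : set R) (e : R) :
  (@lebesgue_measure R).-negligible N -> 0 < e ->
  exists U : set R, [/\ open U, N `<=` U & (@lebesgue_measure R U < e%:E)%E].
Proof.
move=> [A [mA A0 NA]] e0.
have Aoo : (@lebesgue_measure R A < +oo)%E.
  by have -> : @lebesgue_measure R A = 0%E by exact: A0; exact: ltry.
have [U [oO AO mO]] := lebesgue_regularity_outer mA Aoo e0.
exists U; split => //; first exact: subset_trans AO.
have mO' : measurable (U : set (measurableTypeR R)) by exact: open_measurable.
rewrite (@measureDI _ _ _ (@lebesgue_measure R) U A)//.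
rewrite [X in (_ + X)%E](_ : _ = 0%E) ?adde0//.
by apply: (@subset_measure0 _ _ _ (@lebesgue_measure R) (U `&` A) A) => //; exact: measurableI.
Qed.

(* The increments of [g] are charged to [e * (s - a)] away from [N], and to
   finitely many intervals inside a small open cover of [N] otherwise. *)
Lemma abs_cont_nonincr (R : realType) (g : R -> R) (a b : R) (N : set R) : a <= b ->
  abs_cont_on g a b -> (@lebesgue_measure R).-negligible N ->
  (forall t, a < t -> t < b -> ~ N t -> exists2 D : R, D <= 0 & is_derive t 1 g D) ->
  g b <= g a.
Proof.
move=> ab acg nN dg.
suff H (e : R) : 0 < e -> g b - g a <= e * (b - a) + e.
  rewrite -subr_le0 leNgt; apply/negP => gab.
  have p : 0 < 2 * (b - a + 1) by lra.
  (* For this [e] the right-hand side is half of [g b - g a], which is absurd when that difference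
     is positive. *)
  have := H ((g b - g a) / (2 * (b - a + 1))) ltac:(by rewrite divr_gt0).
  have -> : (g b - g a) / (2 * (b - a + 1)) * (b - a) + (g b - g a) / (2 * (b - a + 1))
    = (g b - g a) / 2 by field; apply/lt0r_neq0; lra.
  lra.
move=> e0; have [dl dl0 Hdl] := acg e e0.
(* The derivative is only controlled inside the interval, so the endpoints join the exceptional
   set. *)
have nN' : (@lebesgue_measure R).-negligible (N `|` [set a] `|` [set b]).
  by do 2?[apply: negligibleU; last exact: negligible_set1].
have [U [oO NO muO]] := negligible_open_cover nN' dl0.
have mO : measurable (U : set (measurableTypeR R)) by exact: open_measurable.
(* The total length of the family is compared with the measure of [U] up to [s], so that at [s = b]
   it is below [dl] and absolute continuity applies. *)
pose G s := exists n : nat, exists a' b' : nat -> R, [/\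
   (forall i, (i < n)%N -> a <= a' i /\ a' i <= b' i /\ b' i <= s),
   (forall i, (i.+1 < n)%N -> b' i <= a' i.+1),
   ((\sum_(i < n) (b' i - a' i))%:E <= @lebesgue_measure R (U `&` `[a, s]))%E &
   g s - g a <= e * (s - a) + \sum_(i < n) `|g (b' i) - g (a' i)|].
have : G b.
  apply: (@cousin_ind _ a) => //.
    exists 0%N, (fun=> 0), (fun=> 0); split => //; first by rewrite big_ord0.
    by rewrite big_ord0; lra.
  move=> c ac cb.
  have [Oc|Oc] := pselect (U c); last first.
    have [D D0 gD] : exists2 D : R, D <= 0 & is_derive c 1 g D.
      apply: dg.
      - by rewrite lt_neqAle ac andbT; apply/eqP => acE; apply/Oc/NO; left; right.
      - by rewrite lt_neqAle cb andbT; apply/eqP => acE; apply/Oc/NO; right.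
      - by move=> Nc; apply/Oc/NO; left; left.
    have [h h0 Hh] := is_derive_straddle gD D0 e0.
    exists h => // s s' as_ sc cs' s'b hs hs' [n [a' [b' [H1 H2 H3 H4]]]].
    exists n, a', b'; split => //.
    - by move=> i ni; have [? [? ?]] := H1 i ni; lra.
    - apply: (le_trans H3); apply: le_measure; rewrite ?inE.
      + by apply: measurableI => //; exact: measurable_itv.
      + by apply: measurableI => //; exact: measurable_itv.
      + by apply: setIS; apply: subset_itvl; rewrite bnd_simp; lra.
    - by have := Hh s s' sc cs' hs hs'; lra.
  (* Around [c] the whole of [[s, s']] lies in [U] and becomes the last interval of the family.
     Measures add up because []s, s']] is disjoint from [[a, s]]. *)
  have /nbhs_ballP[h/= h0 Hh] : nbhs c U by exact: open_nbhs_nbhs.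
  exists h => // s s' as_ sc cs' s'b hs hs' [n [a' [b' [H1 H2 H3 H4]]]].
  exists n.+1, (fun i => if (i < n)%N then a' i else s),
    (fun i => if (i < n)%N then b' i else s'); split.
  - move=> i; rewrite ltnS leq_eqVlt => /orP[/eqP->|ni]; first by rewrite ltnn; lra.
    by rewrite ni; have [? [? ?]] := H1 i ni; lra.
  - move=> i; rewrite ltnS => ni; rewrite ni.
    case: ifP => ni1; first exact: H2.
    by have [? [? ?]] := H1 i ni; lra.
  - rewrite big_ord_recr/= ltnn.
    under eq_bigr do rewrite ltn_ord.
    rewrite EFinD.
    apply: (@le_trans _ _ (lebesgue_measure (U `&` `[a, s]) + lebesgue_measure (`]s, s']%classic : set R))%E).
      apply: leeD => //; rewrite lebesgue_measure_itv/= lte_fin; case: ifP => // ss'.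
      by rewrite lee_fin; move: ss' => /negbT; rewrite -leNgt; lra.
    rewrite -measureU//=.
    + apply: le_measure; rewrite ?inE//.
      * by apply: measurableU; [apply: measurableI|]; rewrite //; exact: measurable_itv.
      * by apply: measurableI => //; exact: measurable_itv.
      * move=> x [[Ox]|]; rewrite /= !in_itv/= => /andP[x1 x2]; split => //=;
          rewrite ?in_itv/=.
        - by apply/andP; split; lra.
        - by apply: Hh; rewrite /ball/= ltr_norml; apply/andP; split; lra.
        - by apply/andP; split; lra.
    + by apply: measurableI => //; exact: measurable_itv.
    + rewrite -subset0 => x [[_]]; rewrite /= !in_itv/= => /andP[_ xs] /andP[sx _].
      by move: sx; rewrite ltNge xs.
  - rewrite big_ord_recr/= ltnn.
    under eq_bigr do rewrite ltn_ord.
    have := ler_norm (g s' - g s).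
    have : 0 <= e * (s' - s) by rewrite mulr_ge0; lra.
    lra.
move=> [n [a' [b' [H1 H2 H3 H4]]]].
apply: (le_trans H4); rewrite lerD2l; apply/ltW/Hdl => //.
rewrite -lte_fin; apply: (le_lt_trans H3); apply: le_lt_trans muO.
apply: le_measure; rewrite ?inE//.
by apply: measurableI => //; exact: measurable_itv.
Qed.

(** * The Filippov map of the vector field *)

Section filippov_map.
Variable R : realType.
Implicit Types (Z : R * R -> R * R) (p q : R * R) (S C : set (R * R)).

(** Since the axis may be removed as a null set, the arbitrary values [Z0] never reach the Filippov
    set. *)
Lemma null2_axis : null2 [set p : R * R | p.1 = 0].
Proof.
exists ([set 0] `*` setT); split.
- by apply: measurableX; [exact: (@measurable_set1 R 0)|exact: measurableT].
- rewrite product_measure1E//=.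
  by rewrite lebesgue_measure_set1 mul0e.
- by move=> p /=.
Qed.

Lemma null2_ball S p r : null2 S -> 0 < r -> exists q, ball p r q /\ ~ S q.
Proof.
move=> [A [mA A0 SA]] r0; apply: contrapT => H.
have bA : ball p.1 r `*` ball p.2 r `<=` A.
  move=> q [q1 q2]; apply: SA; apply: contrapT => Sq; apply: H; exists q; split => //.
have mb : measurable ((ball p.1 r `*` ball p.2 r) : set (measurableTypeR R * measurableTypeR R)).
  by apply: measurableX; exact: measurable_ball.
have : ((@lebesgue_measure R \x @lebesgue_measure R) (ball p.1 r `*` ball p.2 r) <= 0)%E.
  rewrite -A0; apply: le_measure => //; rewrite inE//.
have mbE (x : R) : lebesgue_measure (ball x r) = (r *+ 2)%:E by rewrite lebesgue_measure_ball ?ltW.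
have -> : ((@lebesgue_measure R \x @lebesgue_measure R) (ball p.1 r `*` ball p.2 r) =
    (r *+ 2)%:E * (r *+ 2)%:E)%E.
  apply: etrans (product_measure1E _ _ _ _) _; [exact: measurable_ball..|].
  by congr (_ * _)%E; exact: mbE.
rewrite -EFinM lee_fin leNgt => /negP; apply.
by rewrite mulr_gt0// mulrn_wgt0.
Qed.

Lemma ball2E p q r : ball p r q <-> (`|p.1 - q.1| < r /\ `|p.2 - q.2| < r).
Proof. by []. Qed.

(** A half-plane is closed and convex, so a linear inequality satisfied by the field near [p] and
    off the axis passes to the Filippov set. *)
Lemma filippov_map_le Z p q (a b c : R) : filippov_map Z p q ->
  (exists2 h : R, 0 < h & forall y, ball p h y -> y.1 != 0 ->
     a * (Z y).1 + b * (Z y).2 <= c) ->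
  a * q.1 + b * q.2 <= c.
Proof.
move=> Fq [h h0 H].
have := Fq h h0 _ null2_axis [set y | a * y.1 + b * y.2 <= c]; apply; split.
  apply: (preimage_closed (f := fun y : R * R => a * y.1 + b * y.2) (D := [set y | y <= c])).
    by move=> y _; apply: cvgD; apply: cvgM; [exact: cvg_cst|exact: cvg_fst|exact: cvg_cst|exact: cvg_snd].
  exact: closed_le.
split.
  move=> u v /= hu hv l /andP[l0 l1].
  have : l * (a * u.1 + b * u.2) <= l * c by rewrite ler_wpM2l.
  have : (1 - l) * (a * v.1 + b * v.2) <= (1 - l) * c by rewrite ler_wpM2l// subr_ge0.
  lra.
move=> _ [y [yb y0] <-] /=; apply: H => //.
by apply/eqP.
Qed.

(* The small balls need not be centred at [p]: at the origin they are taken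
   inside a half-plane. *)
Lemma filippov_map_adherent Z (G : R * R -> R * R) p (h : R) S C :
  {for p, continuous G} ->
  (forall e : R, 0 < e -> exists q, exists r : R, [/\ 0 < r, ball q r `<=` ball p e &
     forall y, ball q r y -> Z y = G y]) ->
  0 < h -> null2 S -> closed C -> Z @` (ball p h `\` S) `<=` C -> C (G p).
Proof.
move=> cG ZG h0 nS cC ZC; apply: cC => V /cG/= /nbhs_ballP[e/= e0 He].
have he0 : 0 < Num.min h e by rewrite lt_min h0.
have [q [r [r0 qp ZGq]]] := ZG _ he0.
have [y [qy Sy]] := null2_ball q nS r0.
have /ball2E[] := qp _ qy; rewrite !lt_min => /andP[y1 y2] /andP[y3 y4].
exists (G y); split; last by apply: He; apply/ball2E.
by apply: ZC; exists y; rewrite ?ZGq//; split => //; apply/ball2E.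
Qed.

Lemma continuous_affine2 (k K m : R) :
  continuous (fun p : R * R => (p.2, - k * p.2 - K * p.1 + m)).
Proof.
move=> p; have h1 : (fun p : R * R => p.2) @ p --> p.2 by exact: cvg_snd.
have h2 : (fun p : R * R => - k * p.2 - K * p.1 + m) @ p --> - k * p.2 - K * p.1 + m.
  apply: (@cvgD _ R^o); last exact: cvg_cst.
  apply: (@cvgB _ R^o); apply: cvgM; [exact: cvg_cst|exact: cvg_snd|exact: cvg_cst|exact: cvg_fst].
exact: cvg_pair h1 h2.
Qed.

End filippov_map.

(** * The Filippov sets of the bonding field *)

Section csb.
Variables (R : realType) (k0 k1 k2 d : R) (Z0 : R -> R * R).
Hypotheses (k0_gt0 : 0 < k0) (k1_gt0 : 0 < k1) (k2_gt0 : 0 < k2) (d_gt0 : 0 < d).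
Variable k : R.
Hypothesis kE : k0 + k1 = k.
Local Notation Z := (csb_field k0 k1 k2 d Z0).
Implicit Types p q : R * R.

Lemma csb_fieldE p : p.1 != 0 ->
  Z p = (p.2, - k * p.2 - k2 * p.1 + k2 * d * Num.sg p.1).
Proof.
move=> p0; rewrite /csb_field (negbTE p0).
have e : p.1 / `|p.1| = Num.sg p.1 by rewrite {1}[p.1]numEsg mulfK ?normr_eq0.
rewrite e sqr_sg p0 -kE; congr (_, _).
have e2 : `|p.1| * Num.sg p.1 = p.1 by rewrite mulrC -numEsg.
transitivity (- (k0 + k1) * p.2 - k2 * (`|p.1| * Num.sg p.1) + k2 * d * Num.sg p.1); last by rewrite e2.
by rewrite /=; ring.
Qed.

(** The field is a continuous affine part plus the jump term [k2 d sg x]. If the jump term stays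
    within [r] of [m] near [p], four half-planes confine [q], up to an arbitrary [e]. Off the axis
    [r = 0] is possible; everywhere [m = 0] and [r = k2 d] work. *)
Lemma csb_filippov_bound p q (m r : R) : filippov_map Z p q ->
  (exists2 h : R, 0 < h & forall y, ball p h y -> y.1 != 0 ->
     `|k2 * d * Num.sg y.1 - m| <= r) ->
  q.1 = p.2 /\ `|q.2 + k * p.2 + k2 * p.1 - m| <= r.
Proof.
move=> Fq [h h0 H].
have k2_gt0' := k2_gt0.
have k_gt0 : 0 < k by rewrite -kE addr_gt0.
suff A (e : R) : 0 < e -> `|q.1 - p.2| <= e /\ `|q.2 + k * p.2 + k2 * p.1 - m| <= r + e.
  split; last by apply/ler_addgt0Pr => e /A[].
  apply/eqP; rewrite -subr_eq0 -normr_le0; apply/ler_addgt0Pr => e /A[].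
  by rewrite add0r.
move=> e0.
(* Within distance [e / (1 + k + k2)] of [p], both the first component and the affine part of the
   second vary by at most [e]. *)
have s0 : 0 < 1 + k + k2 by lra.
have [h' [h'0 h'h h'e]] : exists h' : R, [/\ 0 < h', h' <= h & h' <= e / (1 + k + k2)].
  by exists (Num.min h (e / (1 + k + k2))); rewrite lt_min h0 divr_gt0// !ge_min !lexx orbT.
have near y : ball p h' y -> y.1 != 0 -> [/\ `|(Z y).1 - p.2| <= e &
    `|(Z y).2 + k * p.2 + k2 * p.1 - m| <= r + e].
  move=> /ball2E[u1 u2] y0.
  have y1 := lt_le_trans u1 h'h; have y2 := lt_le_trans u1 h'e.
  have y3 := lt_le_trans u2 h'h; have y4 := lt_le_trans u2 h'e.
  have := H y; rewrite ball2E => /(_ (conj y1 y3) y0) Hy.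
  rewrite csb_fieldE//=; move: y2 y4; rewrite !ltr_pdivlMr// => y2 y4; split.
    rewrite distrC; apply/ltW/(le_lt_trans _ y4).
    by rewrite ler_peMr//; lra.
  have -> : - k * y.2 - k2 * y.1 + k2 * d * Num.sg y.1 + k * p.2 + k2 * p.1 - m =
    (k2 * d * Num.sg y.1 - m) + (k * (p.2 - y.2) + k2 * (p.1 - y.1)) by ring.
  rewrite (le_trans (ler_normD _ _))// lerD//.
  rewrite (le_trans (ler_normD _ _))// !normrM (gtr0_norm k_gt0) (gtr0_norm k2_gt0).
  have := normr_ge0 (p.1 - y.1); have := normr_ge0 (p.2 - y.2).
  move: y2 y4; set u := `|p.1 - y.1|; set v := `|p.2 - y.2| => y2 y4 v0 u0.
  have : u * k2 + v * k < e.
    have [uv|vu] := leP u v.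
      apply: le_lt_trans y4; have : u * k2 <= v * k2 by rewrite ler_pM2r.
      by lra.
    apply: le_lt_trans y2; have : v * k <= u * k by rewrite ler_pM2r// ltW.
    by lra.
  by lra.
have F (a b c : R) : (forall y, ball p h' y -> y.1 != 0 -> a * (Z y).1 + b * (Z y).2 <= c) ->
    a * q.1 + b * q.2 <= c.
  by move=> Hc; apply: filippov_map_le Fq _; exists h'.
split; rewrite ler_norml; apply/andP; split.
- suff : -1 * q.1 + 0 * q.2 <= e - p.2 by lra.
  by apply: F => y yp y0; have [] := near y yp y0; rewrite ler_norml => /andP[? ?] _; lra.
- suff : 1 * q.1 + 0 * q.2 <= e + p.2 by lra.
  by apply: F => y yp y0; have [] := near y yp y0; rewrite ler_norml => /andP[? ?] _; lra.
- suff : 0 * q.1 + -1 * q.2 <= r + e + k * p.2 + k2 * p.1 - m by lra.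
  by apply: F => y yp y0; have [] := near y yp y0; rewrite !ler_norml => _ /andP[? ?]; lra.
- suff : 0 * q.1 + 1 * q.2 <= r + e - k * p.2 - k2 * p.1 + m by lra.
  by apply: F => y yp y0; have [] := near y yp y0; rewrite !ler_norml => _ /andP[? ?]; lra.
Qed.

Lemma csb_filippov_sub p q : filippov_map Z p q ->
  q.1 = p.2 /\ `|q.2 + k * p.2 + k2 * p.1| <= k2 * d.
Proof.
move=> Fq; have [|-> H] := @csb_filippov_bound p q 0 (k2 * d) Fq; last by rewrite subr0 in H.
exists 1 => // y _ y0; rewrite subr0 normrM normr_sg y0 mulr1 gtr0_norm ?mulr_gt0//.
Qed.

Lemma sgr_ball (x y : R) : `|x - y| < `|x| -> Num.sg y = Num.sg x.
Proof.
have [x0|x0|->] := ltrgtP x 0; last by rewrite normr0 normr_lt0.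
  rewrite (ltr0_norm x0) ltr_norml => /andP[? ?].
  by rewrite (ltr0_sg x0) ltr0_sg//; lra.
rewrite (gtr0_norm x0) ltr_norml => /andP[? ?].
by rewrite (gtr0_sg x0) gtr0_sg//; lra.
Qed.

Lemma csb_filippov_off p : p.1 != 0 -> filippov_map Z p = [set Z p].
Proof.
move=> p0; apply/seteqP; split => [q Fq|_ ->].
  have [|q1] := @csb_filippov_bound p q (k2 * d * Num.sg p.1) 0 Fq.
    exists `|p.1|; first by rewrite normr_gt0.
    by move=> y /ball2E[yp _] _; rewrite (sgr_ball yp) subrr normr0.
  rewrite normr_le0 csb_fieldE// => /eqP q2 /=.
  by rewrite [q]surjective_pairing q1; congr (_, _); lra.
move=> h h0 S nS C [cC [_ ZC]].
rewrite csb_fieldE//.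
apply: (filippov_map_adherent (Z := Z) (@continuous_affine2 _ k k2 (k2 * d * Num.sg p.1) p) _ h0 nS cC ZC).
move=> e e0; exists p, (Num.min e `|p.1|); split.
- by rewrite lt_min e0 normr_gt0.
- by apply: le_ball; rewrite ge_min lexx.
- move=> y /ball2E; rewrite !lt_min => -[/andP[_ y1] _].
  have sy := sgr_ball y1.
  by rewrite csb_fieldE ?sy// -sgr_eq0 sy sgr_eq0.
Qed.

(** The limits of the field at the origin from the two half-planes are [(0, k2 d)] and
    [(0, - k2 d)]. Both belong to every admissible closed convex set, hence so does their
    midpoint. *)
Lemma csb_filippov_origin : filippov_map Z (0, 0) (0, 0).
Proof.
move=> h h0 S nS C [cC [xC ZC]].
have half (s : R) : s != 0 -> Num.sg s = s -> C (0, k2 * d * s).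
  move=> s0 ss.
  have -> : (0, k2 * d * s) = (fun p : R * R => (p.2, - k * p.2 - k2 * p.1 + k2 * d * s)) (0, 0).
    by rewrite /=; congr (_, _); ring.
  apply: (filippov_map_adherent (Z := Z) (@continuous_affine2 _ k k2 (k2 * d * s) (0, 0)) _ h0 nS cC ZC).
  move=> e e0; have e2 : 0 < e / 2 by rewrite divr_gt0.
  have s1 : `|s| = 1 by rewrite -ss normr_sg s0.
  have se : `|s * (e / 2)| = e / 2 by rewrite normrM s1 mul1r gtr0_norm.
  (* This ball touches the axis only from outside: it lies in the open half-plane of sign [s] and
     within [e] of the origin. *)
  exists (s * (e / 2), 0), (e / 2); split => //.
  - move=> y /ball2E[/= y1 y2]; apply/ball2E => /=; split; last by lra.
    have -> : 0 - y.1 = (s * (e / 2) - y.1) - s * (e / 2) by ring.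
    by rewrite (le_lt_trans (ler_normB _ _))// se; lra.
  - move=> y /ball2E[/= y1 _].
    have sy : Num.sg y.1 = s by rewrite (@sgr_ball (s * (e / 2)) y.1) ?se// sgrM ss (gtr0_sg e2) mulr1.
    by rewrite csb_fieldE ?sy// -sgr_eq0 sy.
have C1 := half 1 (oner_neq0 _) (@sgr1 _).
have C2 : C (0, k2 * d * -1) by apply: half; rewrite ?oppr_eq0 ?oner_neq0// sgrN1.
have := xC _ _ C1 C2 (1/2); rewrite /=.
have -> : (1 / 2 * 0 + (1 - 1 / 2) * 0, 1 / 2 * (k2 * d * 1) + (1 - 1 / 2) * (k2 * d * -1)) = (0, 0) :> R * R.
  by congr (_, _); field.
by apply; apply/andP; split; lra.
Qed.

End csb.

(** * Solutions away from the origin *)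

Section calculus.
Variable R : realType.
Implicit Types (f g : R -> R) (t : R).

Lemma deriveD_fun f g t (a b : R) : is_derive t 1 f a -> is_derive t 1 g b ->
  is_derive t 1 (fun s => f s + g s) (a + b).
Proof. by move=> fa gb; exact: is_deriveD. Qed.

Lemma deriveM_fun f g t (a b : R) : is_derive t 1 f a -> is_derive t 1 g b ->
  is_derive t 1 (fun s => f s * g s) (a * g t + f t * b).
Proof.
move=> fa gb; have := is_deriveM fa gb => /is_derive_eq; apply.
by rewrite /GRing.scale/= addrC mulrC.
Qed.

Lemma derive_cst_fun (c t : R) : is_derive t 1 (fun=> c) 0.
Proof. exact: is_derive_cst. Qed.

Lemma derive_id_fun t : is_derive t 1 (fun s : R => s) 1.
Proof. exact: is_derive_id. Qed.

Lemma deriveZ_fun f t (c a : R) : is_derive t 1 f a -> is_derive t 1 (fun s => c * f s) (c * a).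
Proof.
move=> fa; have := deriveM_fun (derive_cst_fun c t) fa => /is_derive_eq; apply; ring.
Qed.

Lemma continuous_dist f t e : continuous f -> 0 < e ->
  exists2 h : R, 0 < h & forall s, `|s - t| < h -> `|f s - f t| < e.
Proof.
move=> cf e0; have /cvgrPdist_lt/(_ _ e0)/nbhs_ballP[h/= h0 H] := cf t.
exists h => // s st; rewrite distrC; apply: H; by rewrite /ball/= distrC.
Qed.

Lemma continuous_le_left f (a c A : R) : continuous f -> a < c ->
  (forall s, a <= s -> s < c -> f s <= A) -> f c <= A.
Proof.
move=> cf ac H; rewrite leNgt; apply/negP => Afc.
have [h h0 Hh] := @continuous_dist f c (f c - A) cf ltac:(lra).
have m1 : Num.max a (c - h / 2) < c by rewrite gt_max ac/=; lra.
have m2 : a <= Num.max a (c - h / 2) by rewrite le_max lexx.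
have m3 : c - h / 2 <= Num.max a (c - h / 2) by rewrite le_max lexx orbT.
have := H _ m2 m1; have := Hh (Num.max a (c - h / 2)).
by rewrite !ltr_norml => /(_ ltac:(apply/andP; split; lra))/andP[? ?]; lra.
Qed.

Lemma continuous_bounded f (a b : R) : continuous f ->
  exists M : R, forall t, a <= t -> t <= b -> `|f t| <= M.
Proof.
move=> cf; have [ab|ba] := leP a b; last by exists 0 => t ? ?; exfalso; lra.
have cn : {within `[a, b], continuous (fun t => `|f t|)}.
  by apply: continuous_subspaceT => t; apply: continuous_comp; [exact: cf|exact: norm_continuous].
have [c _ H] := EVT_max ab cn.
by exists `|f c| => t at_ tb; apply: H; rewrite in_itv/= at_ tb.
Qed.

Lemma abs_cont_sqr f (a b : R) : continuous f -> abs_cont_on f a b ->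
  abs_cont_on (fun t => f t * f t) a b.
Proof. by move=> cf acf; have [M HM] := continuous_bounded a b cf; exact: (abs_contM HM HM). Qed.

Lemma continuous_sgr f (a b : R) : continuous f -> a <= b ->
  (forall t, a <= t -> t <= b -> f t != 0) -> Num.sg (f b) = Num.sg (f a).
Proof.
move=> cf ab H.
have fa := H a (lexx _) ab; have fb := H b ab (lexx _).
have [E|] := eqVneq (Num.sg (f b)) (Num.sg (f a)); first by [].
move=> sne; exfalso.
have [c] : exists2 c, c \in `[a, b] & f c = 0.
  apply: IVT => //; first exact: continuous_subspaceT.
  move: sne fa fb; rewrite ge_min le_max.
  by case: (sgrP (f a)) => // ?; case: (sgrP (f b)) => //; rewrite ?eqxx// => ? _ _ _;
    apply/andP; split; apply/orP; solve [left; lra|right; lra].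
by rewrite in_itv/= => /andP[ac cb] fc; have := H c ac cb; rewrite fc eqxx.
Qed.

(** The derivative of [w ^ 2 + K y ^ 2] is [- 2 k w ^ 2], at most [- 2 k m ^ 2]. Taking [m = 0]
    gives monotonicity, and a positive [m] gives a definite loss per unit of time. *)
Lemma damped_decay (k K m a b : R) (y w : R -> R) (N : set R) :
  a <= b -> 0 <= k -> 0 <= m -> continuous y -> continuous w ->
  abs_cont_on y a b -> abs_cont_on w a b -> (@lebesgue_measure R).-negligible N ->
  (forall t, a < t -> t < b -> m <= `|w t|) ->
  (forall t, a < t -> t < b -> ~ N t ->
     is_derive t 1 y (w t) /\ is_derive t 1 w (- k * w t - K * y t)) ->
  w b * w b + K * (y b * y b) + 2 * k * m ^+ 2 * (b - a) <= w a * w a + K * (y a * y a).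
Proof.
move=> ab k_ge0 m_ge0 cy cw acy acw nN mw ode.
pose g t := w t * w t + (K * (y t * y t) + 2 * k * m ^+ 2 * t).
suff : g b <= g a by rewrite /g; lra.
apply: (abs_cont_nonincr (N := N)) => //.
  apply: abs_contD; first exact: abs_cont_sqr.
  apply: abs_contD; first by apply: abs_contZ; exact: abs_cont_sqr.
  by apply: abs_contZ; apply: (abs_cont_lip (L := 1)) => s t _ st _; rewrite mul1r ger0_norm ?subr_ge0.
move=> t at_ tb Nt; have [dy dw] := ode t at_ tb Nt.
exists (- (2 * k * (`|w t| ^+ 2 - m ^+ 2))).
  rewrite oppr_le0 mulr_ge0 ?mulr_ge0// subr_ge0 ler_sqr ?nnegrE//; exact: mw.
have := deriveD_fun (deriveM_fun dw dw) (deriveD_fun (deriveZ_fun K (deriveM_fun dy dy))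
  (deriveZ_fun (2 * k * m ^+ 2) (derive_id_fun t))).
move=> /is_derive_eq; apply; rewrite real_normK ?num_real//; ring.
Qed.

Lemma abs_cont_growth f (a b L : R) (N : set R) : a <= b -> abs_cont_on f a b ->
  (@lebesgue_measure R).-negligible N ->
  (forall t, a < t -> t < b -> ~ N t -> exists2 D : R, L <= D & is_derive t 1 f D) ->
  L * (b - a) <= f b - f a.
Proof.
move=> ab acf nN df.
suff : L * b + -1 * f b <= L * a + -1 * f a by lra.
apply: (abs_cont_nonincr (N := N) (g := fun t => L * t + -1 * f t)) => //.
  apply: abs_contD; apply: abs_contZ => //.
  by apply: (abs_cont_lip (L := 1)) => s t _ st _; rewrite mul1r ger0_norm ?subr_ge0.
move=> t at_ tb Nt; have [D LD fD] := df t at_ tb Nt.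
exists (L * 1 + -1 * D); first lra.
by apply: deriveD_fun; apply: deriveZ_fun => //; exact: derive_id_fun.
Qed.

End calculus.

(** * From Filippov solutions to oscillator equations almost everywhere *)

Section bond_sol.
Variable R : realType.
Implicit Types (k K d : R) (x v : R -> R).

(* A consequence of being a Filippov solution which suffices here: while [x = 0]
   only a bound on the derivative of [v] is kept. *)
Definition bond_sol k K d x v := [/\ continuous x, continuous v,
  (forall T, 0 <= T -> abs_cont_on x 0 T /\ abs_cont_on v 0 T) &
  exists2 N, (@lebesgue_measure R).-negligible N & forall t, 0 < t -> ~ N t ->
    exists b, [/\ is_derive t 1 x (v t), is_derive t 1 v b,
      `|b + k * v t + K * x t| <= K * d &
      x t != 0 -> b = - k * v t - K * x t + K * d * Num.sg (x t)]].

(** Trajectories are unconstrained at negative times. Freezing time at 0 makes them continuous on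
    the whole line without changing them on [[0, oo)]. *)
Lemma continuous_clamp (f : R -> R) : (forall T, 0 <= T -> abs_cont_on f 0 T) ->
  continuous (fun t : R => f (Num.max 0 t)).
Proof.
move=> acf t; apply/cvgrPdist_lt => e e0.
have T0 : 0 <= `|t| + 1 by have := normr_ge0 t; lra.
have [dl dl0 H] := abs_cont_dist (acf _ T0) e0.
apply/nbhs_ballP; exists (Num.min dl 1); first by rewrite /= lt_min dl0 ltr01.
move=> s; rewrite /ball/= lt_min => /andP[ts1 ts2]; apply: H; rewrite ?le_max ?lexx//.
- rewrite ge_max T0/=; move: ts2; rewrite ltr_norml => /andP[? ?].
  by have := ler_norm t; lra.
- by rewrite ge_max T0/=; have := ler_norm t; lra.
- apply: le_lt_trans ts1.
  rewrite !maxElt; case: ifP => h1; case: ifP => h2; move: h1 h2 => /= h1 h2;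
   by rewrite ?subrr ?normr0//; rewrite ler_norml; have := ler_norm (t - s);
   have := ler_norm (-(t - s)); rewrite normrN => ? ?; apply/andP; split; lra.
Qed.

Lemma is_derive_eq_itv (f g : R -> R) (a b t D : R) : a < t -> t < b ->
  (forall s, a < s -> s < b -> f s = g s) -> is_derive t 1 f D -> is_derive t 1 g D.
Proof.
move=> at_ tb fg; apply: near_eq_is_derive.
near=> s; apply: fg; near: s; [exact: lt_nbhsr|exact: lt_nbhsl].
Unshelve. all: by end_near. Qed.

Lemma filippov_bond_sol (k0 k1 k2 d : R) (Z0 : R -> R * R) (z : R -> R * R) :
  0 < k0 -> 0 < k1 -> 0 < k2 -> 0 < d ->
  filippov_sol (csb_field k0 k1 k2 d Z0) z ->
  bond_sol (k0 + k1) k2 d (fun t : R => (z (Num.max 0 t)).1) (fun t : R => (z (Num.max 0 t)).2).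
Proof.
move=> k00 k10 k20 d0 [acz [N [nN ode]]]; split.
- by apply: (continuous_clamp (f := fun t => (z t).1)) => T /acz[].
- by apply: (continuous_clamp (f := fun t => (z t).2)) => T /acz[].
- move=> T /acz[ac1 ac2]; split.
    by apply: eq_abs_cont ac1 => t t0 _; rewrite max_r.
  by apply: eq_abs_cont ac2 => t t0 _; rewrite max_r.
exists N => // t t0 Nt; have [dx [dv Ft]] := ode t (ltW t0) Nt.
have dx' : is_derive t 1 (fun t => (z t).1) (derive1 (fun s => (z s).1) t).
  by apply: DeriveDef => //; rewrite derive1E.
have dv' : is_derive t 1 (fun t => (z t).2) (derive1 (fun s => (z s).2) t).
  by apply: DeriveDef => //; rewrite derive1E.
have [/= ex bnd] := csb_filippov_sub k00 k10 k20 d0 erefl Ft.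
exists (derive1 (fun s => (z s).2) t); have t1 : t < t + 1 by rewrite ltrDl.
rewrite (max_r (ltW t0)); split => //.
- rewrite -ex; apply: (is_derive_eq_itv t0 t1 _ dx') => // s s0 _; by rewrite (max_r (ltW s0)).
- apply: (is_derive_eq_itv t0 t1 _ dv') => // s s0 _; by rewrite (max_r (ltW s0)).
- move=> x0; move: Ft; rewrite (csb_filippov_off d Z0 k00 k10 k20 erefl)// => /=.
  by rewrite (csb_fieldE k2 d Z0 erefl)// => -[].
Qed.

End bond_sol.

(** * Crossing the axis, energy decay and uniqueness away from the origin *)

Section dynamics.
Variable R : realType.
Implicit Types (k K d : R) (x v : R -> R).

(* The side of [x = 0] which a trajectory through [(x, v) <> (0, 0)] enters. *)
Definition exit_side (x v : R) : R := if x == 0 then Num.sg v else Num.sg x.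

Lemma exit_sideP (x v : R) : (x, v) != (0, 0) -> exit_side x v = 1 \/ exit_side x v = -1.
Proof.
rewrite /exit_side xpair_eqE negb_and; case: (eqVneq x 0) => [_ /= v0|x0 _].
  by case: sgrP v0 => //; [left|right].
by case: sgrP x0 => //; [left|right].
Qed.

Lemma sgr_of_pos (s x : R) : s = 1 \/ s = -1 -> 0 < s * x -> Num.sg x = s.
Proof.
by move=> [->|->]; rewrite ?mul1r ?mulN1r ?oppr_gt0 => h; rewrite ?(gtr0_sg h)// (ltr0_sg h).
Qed.

(** Off the axis this is continuity of [x]. On the axis [v c <> 0], and as long as [v] stays within
    [|v c| / 2] of [v c], the product of [x] and the sign of [v c] grows at rate at least
    [|v c| / 2]. *)
Lemma exit_side_enter k K d x v c : bond_sol k K d x v -> 0 <= c ->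
  (x c, v c) != (0, 0) -> exists2 h : R, 0 < h &
  forall t, c < t -> t <= c + h -> 0 < exit_side (x c) (v c) * x t.
Proof.
move=> [cx cv ac [N nN ode]] c0 xv0; have sd := exit_sideP xv0.
move: sd; rewrite /exit_side; have [x0|x0] := eqVneq (x c) 0 => sd; last first.
  have [h h0 H] := @continuous_dist R x c `|x c| cx ltac:(by rewrite normr_gt0).
  exists (h / 2); first by lra.
  move=> t ct th; have := H t ltac:(rewrite ger0_norm; lra).
  rewrite distrC => /sgr_ball E; rewrite -E -normrEsg normr_gt0.
  by rewrite -sgr_eq0 E sgr_eq0.
have v0 : v c != 0 by move: xv0; rewrite xpair_eqE x0 eqxx.
have vc0 : 0 < `|v c| by rewrite normr_gt0.
have [h h0 H] := @continuous_dist R v c (`|v c| / 2) cv ltac:(by rewrite divr_gt0).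
exists (h / 2); first by lra.
move=> t ct th.
have := @abs_cont_growth R (fun s => Num.sg (v c) * x s) c t (`|v c| / 2) N (ltW ct).
have acx : abs_cont_on (fun s => Num.sg (v c) * x s) c t.
  by apply: abs_contZ; have [acx _] := ac t ltac:(lra); apply: abs_contS acx => //.
move=> /(_ acx nN) G.
have : `|v c| / 2 * (t - c) <= Num.sg (v c) * x t - Num.sg (v c) * x c.
  apply: G => s cs st Ns; have [b [dx _ _ _]] := ode s ltac:(lra) Ns.
  exists (Num.sg (v c) * v s); last exact: deriveZ_fun.
  have := H s ltac:(rewrite ger0_norm; lra).
  move: sd vc0; rewrite normrEsg => -[] ->; rewrite ?mul1r ?mulN1r ltr_norml => ? /andP[? ?]; lra.
have : 0 < `|v c| / 2 * (t - c) by rewrite mulr_gt0//; lra.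
by rewrite x0; lra.
Qed.

Lemma bond_sol_abs_cont k K d x v a b : bond_sol k K d x v -> 0 <= a -> a <= b ->
  abs_cont_on x a b /\ abs_cont_on v a b.
Proof.
move=> [_ _ ac _] a0 ab; have [acx acv] := ac b ltac:(lra).
by split; [exact: abs_contS acx|exact: abs_contS acv].
Qed.

Lemma bond_sol_eq k K d x v c h (s : R) : bond_sol k K d x v -> 0 <= c ->
  s = 1 \/ s = -1 -> (forall t, c < t -> t <= c + h -> 0 < s * x t) ->
  exists2 N, (@lebesgue_measure R).-negligible N & forall t, c < t -> t <= c + h -> ~ N t ->
    is_derive t 1 x (v t) /\ is_derive t 1 v (- k * v t - K * (x t - s * d)).
Proof.
move=> [_ _ _ [N nN ode]] c0 s1 sx; exists N => // t ct th Nt.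
have sxt := sx t ct th.
have [b [dx dv _ H]] := ode t ltac:(lra) Nt; split => //.
apply: (is_derive_eq dv); rewrite H.
  by rewrite (sgr_of_pos s1 sxt); ring.
by apply/eqP => xt; move: sxt; rewrite xt mulr0 ltxx.
Qed.

Definition bond_energy K d x v (t : R) := v t * v t + K * ((`|x t| - d) * (`|x t| - d)).

Lemma continuous_bond_energy K d x v : continuous x -> continuous v ->
  continuous (bond_energy K d x v).
Proof.
move=> cx cv t; have c1 : (fun t => `|x t| - d) @ t --> `|x t| - d.
  apply: (@cvgB _ R^o); last exact: cvg_cst.
  by apply: (@cvg_norm _ R^o); exact: cx.
apply: (@cvgD _ R^o); first by apply: cvgM; exact: cv.
by apply: cvgM; [exact: cvg_cst|apply: cvgM].
Qed.

(** On the closed side [s] one has [|x| - d = s (x - s d)]. The axis is included, so the energies of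
    the two oscillators agree there and can be chained. *)
Lemma side_energy K d x v (s t : R) : s = 1 \/ s = -1 -> 0 <= s * x t ->
  bond_energy K d x v t = v t * v t + K * ((x t - s * d) * (x t - s * d)).
Proof.
rewrite /bond_energy; move=> [->|->]; rewrite ?mul1r ?mulN1r => h.
  by rewrite ger0_norm.
by rewrite ler0_norm; [ring|lra].
Qed.

Lemma bond_energy_local k K d x v c : 0 < k -> bond_sol k K d x v -> 0 <= c ->
  (x c, v c) != (0, 0) -> exists2 h : R, 0 < h & forall t m, c <= t -> t <= c + h ->
    0 <= m -> (forall s, c < s -> s < t -> m <= `|v s|) ->
    bond_energy K d x v t + 2 * k * m ^+ 2 * (t - c) <= bond_energy K d x v c.
Proof.
move=> k0 sol c0 xv0; have [h h0 H] := exit_side_enter sol c0 xv0.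
exists h => // t m ct th m0 mv.
have sd := exit_sideP xv0; move: (exit_side _ _) sd H => s sd H.
have [cx cv ac _] := sol.
have H0 u : c <= u -> u <= c + h -> 0 <= s * x u.
  rewrite le_eqVlt => /orP[/eqP<- _|cu uh]; last exact/ltW/H.
  (* The sign is known only after [c]. Reflecting time about [c] turns a limit from the right into
     the limit from the left that [continuous_le_left] handles. *)
  have cNx : continuous (fun u => s * x (2 * c - u)).
    move=> u'; apply: cvgM; first exact: cvg_cst.
    apply: (@continuous_comp _ _ _ (fun u => 2 * c - u) x); last exact: cx.
    by apply: (@cvgB _ R^o); [exact: cvg_cst|exact: cvg_id].
  have := @continuous_le_left R (fun u => - (s * x (2 * c - u))) (c - h) c 0.
  have -> : 2 * c - c = c by ring.
  rewrite oppr_le0; apply; [|lra|].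
    by move=> u'; apply: (@cvgN _ R^o); exact: cNx.
  by move=> w hw wc; rewrite oppr_le0; apply/ltW/H; lra.
rewrite (side_energy K d v sd (H0 t ct th)) (side_energy K d v sd (H0 c (lexx _) ltac:(lra))).
have [N nN ode] := bond_sol_eq sol c0 sd H.
have [acx acv] := bond_sol_abs_cont sol c0 ct.
apply: (@damped_decay R k K m c t (fun u => x u - s * d) v N) => //.
- exact: ltW.
- by move=> u; apply: (@cvgB _ R^o); [exact: cx|exact: cvg_cst].
- by apply: abs_contD => //; exact: abs_cont_cst.
- move=> u cu ut Nu; have [dx dv] := ode u cu ltac:(lra) Nu; split => //.
  by apply: (is_derive_eq (deriveD_fun dx (derive_cst_fun (- (s * d)) u))); rewrite addr0.
Qed.

Lemma bond_energy_decay k K d x v a b m : 0 < k -> bond_sol k K d x v -> 0 <= a -> a <= b ->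
  (forall t, 0 <= t -> (x t, v t) != (0, 0)) -> 0 <= m ->
  (forall s, a <= s -> s <= b -> m <= `|v s|) ->
  bond_energy K d x v b + 2 * k * m ^+ 2 * (b - a) <= bond_energy K d x v a.
Proof.
move=> k0 sol a0 ab xv0 m0 mv; have [cx cv _ _] := sol.
pose P t := t <= b -> bond_energy K d x v t + 2 * k * m ^+ 2 * (t - a) <= bond_energy K d x v a.
suff /(_ b ab)/(_ (lexx _)) : forall t, a <= t -> P t by [].
apply: real_ind => [c ac IH cb|c ac Pc].
  move: ac; rewrite le_eqVlt => /orP[/eqP<-|ac]; first by lra.
  apply: (@continuous_le_left R (fun t => bond_energy K d x v t + 2 * k * m ^+ 2 * (t - a)) a c) => //.
    move=> t; apply: (@cvgD _ R^o); first exact: continuous_bond_energy.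
    apply: cvgM; first exact: cvg_cst.
    by apply: (@cvgB _ R^o); [exact: cvg_id|exact: cvg_cst].
  by move=> s as_ sc; apply: IH => //; lra.
have [h h0 H] := bond_energy_local k0 sol (le_trans a0 ac) (xv0 c (le_trans a0 ac)).
exists h => // s cs sh sb; have := Pc ltac:(lra).
have := H s m (ltW cs) sh m0 ltac:(by move=> u cu us; apply: mv; lra).
lra.
Qed.

Lemma bond_sol_unique k K d x v x' v' : 0 < k -> 0 < K -> bond_sol k K d x v ->
  bond_sol k K d x' v' -> x 0 = x' 0 -> v 0 = v' 0 ->
  (forall t, 0 <= t -> (x t, v t) != (0, 0)) ->
  forall t, 0 <= t -> x t = x' t /\ v t = v' t.
Proof.
move=> k0 K0 sol sol' x0 v0 xv0.
have [cx cv _ _] := sol; have [cx' cv' _ _] := sol'.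
have closed (f g : R -> R) c : continuous f -> continuous g -> 0 < c ->
    (forall s, 0 <= s -> s < c -> f s = g s) -> f c = g c.
  move=> cf cg c0 fg; apply/eqP; rewrite eq_le -subr_le0 -[in X in _ && X]subr_le0.
  apply/andP; split.
    apply: (@continuous_le_left R (fun s => f s - g s) 0 c) => //.
      by move=> u; apply: (@cvgB _ R^o); [exact: cf|exact: cg].
    by move=> s s0 sc; rewrite fg// subrr.
  apply: (@continuous_le_left R (fun s => g s - f s) 0 c) => //.
    by move=> u; apply: (@cvgB _ R^o); [exact: cg|exact: cf].
  by move=> s s0 sc; rewrite fg// subrr.
apply: real_ind => [c|c c0 [xc vc]].
  rewrite le_eqVlt => /orP[/eqP<-//|c0] IH.
  by split; apply: closed => // s s0 sc; have [] := IH s s0 sc.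
have xvc := xv0 c c0; have sd := exit_sideP xvc.
have [h h0 H] := exit_side_enter sol c0 xvc.
have [h' h'0 H'] := exit_side_enter sol' c0 ltac:(by rewrite -xc -vc).
(* Equal states at [c] have the same exit side, so both solutions obey the same linear equation just
   after [c], and their difference obeys the homogeneous one with zero initial data. *)
move: H'; rewrite -xc -vc; move: (exit_side _ _) sd H => s sd H H'.
have [N nN ode] := bond_sol_eq sol c0 sd H.
have [N' nN' ode'] := bond_sol_eq sol' c0 sd H'.
exists (Num.min h h'); first by rewrite lt_min h0.
move=> t ct; rewrite addr_minr le_min => /andP[th th'].
have [acx acv] := bond_sol_abs_cont sol c0 (ltW ct).
have [acx' acv'] := bond_sol_abs_cont sol' c0 (ltW ct).
have D (f g : R -> R) : abs_cont_on f c t -> abs_cont_on g c t ->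
   abs_cont_on (fun u => f u + -1 * g u) c t.
  by move=> acf acg; apply: abs_contD => //; exact: abs_contZ.
have C (f g : R -> R) : continuous f -> continuous g -> continuous (fun u => f u + -1 * g u).
  move=> cf cg u; apply: (@cvgD _ R^o); first exact: cf.
  by apply: cvgM; [exact: cvg_cst|exact: cg].
have ode2 u : c < u -> u < t -> ~ (N `|` N') u ->
    is_derive u 1 (fun u => x u + -1 * x' u) (v u + -1 * v' u) /\
    is_derive u 1 (fun u => v u + -1 * v' u)
      (- k * (v u + -1 * v' u) - K * (x u + -1 * x' u)).
  move=> cu ut /not_orP[Nu N'u].
  have [dx dv] := ode u cu ltac:(lra) Nu; have [dx' dv'] := ode' u cu ltac:(lra) N'u.
  split; first by apply: deriveD_fun => //; exact: deriveZ_fun.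
  by apply: (is_derive_eq (deriveD_fun dv (deriveZ_fun (-1) dv'))); ring.
have := @damped_decay R k K 0 c t (fun u => x u + -1 * x' u) (fun u => v u + -1 * v' u) (N `|` N')
  (ltW ct) (ltW k0) (lexx _) (C _ _ cx cx') (C _ _ cv cv') (D _ _ acx acx') (D _ _ acv acv')
  (negligibleU nN nN') (fun _ _ _ => normr_ge0 _) ode2.
rewrite xc vc.
set y := x t + _; set w := v t + _ => le0.
have e0 : w * w + K * (y * y) <= 0 by lra.
have w2 : 0 <= w * w by rewrite -expr2 sqr_ge0.
have y2 : 0 <= K * (y * y) by rewrite mulr_ge0 ?(ltW K0)// -expr2 sqr_ge0.
have : w * w = 0 by lra.
have : K * (y * y) = 0 by lra.
move=> /eqP; rewrite mulf_eq0 (gt_eqF K0)/= -expr2 sqrf_eq0 => /eqP yE.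
move=> /eqP; rewrite -expr2 sqrf_eq0 => /eqP wE.
by move: yE wE; rewrite /y /w => ? ?; split; lra.
Qed.

End dynamics.

(** * Convergence *)

Lemma ler_sign_norm (R : realType) (s y : R) : s = 1 \/ s = -1 -> s * y <= `|y|.
Proof.
case=> ->; first by rewrite mul1r ler_norm.
by rewrite mulN1r -normrN ler_norm.
Qed.

Section convergence.
Variables (R : realType) (k K d : R) (x v : R -> R).
Hypotheses (k_gt0 : 0 < k) (K_gt0 : 0 < K) (d_gt0 : 0 < d).
Hypothesis sol : bond_sol k K d x v.
Hypothesis xv_neq0 : forall t, 0 <= t -> (x t, v t) != (0, 0).
Local Notation E := (bond_energy K d x v).

Lemma bond_energy_ge t : K * ((`|x t| - d) * (`|x t| - d)) <= E t /\ v t * v t <= E t.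
Proof.
have h1 : 0 <= v t * v t by rewrite -expr2 sqr_ge0.
have h2 : 0 <= K * ((`|x t| - d) * (`|x t| - d)) by rewrite mulr_ge0 ?(ltW K_gt0)// -expr2 sqr_ge0.
by rewrite /bond_energy; split; lra.
Qed.

Lemma bond_energy_noninc s t : 0 <= s -> s <= t -> E t <= E s.
Proof.
move=> s0 st; have := bond_energy_decay k_gt0 sol s0 st xv_neq0 (lexx _) (fun _ _ _ => normr_ge0 _).
by rewrite expr0n mulr0 mul0r addr0.
Qed.

(** A crude bound that turns energy bounds into bounds on [x] and [v] without square roots. *)
Lemma norm_le_sqr (a b : R) : a * a <= b -> `|a| <= b + 1.
Proof.
move=> ab; rewrite ler_norml.
have := sqr_ge0 (a - 1); have := sqr_ge0 (a + 1); rewrite !expr2 => ? ?.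
by apply/andP; split; nra.
Qed.

Lemma velocity_lipschitz : exists2 L : R, 0 < L & forall s t, 0 <= s -> s <= t ->
  `|v t - v s| <= L * (t - s).
Proof.
have [k0 K0 d0] := And3 k_gt0 K_gt0 d_gt0.
have [_ _ _ [N nN ode]] := sol.
have [M M0 HM] : exists2 M : R, 0 < M & forall t, 0 <= t -> `|v t| <= M /\ `|x t| <= M.
  have E0 : 0 <= E 0.
    by have [_ h] := bond_energy_ge 0; apply: le_trans h; rewrite -expr2 sqr_ge0.
  have EK : 0 <= E 0 / K by rewrite divr_ge0// ltW.
  (* By [norm_le_sqr], [|v| <= E 0 + 1] and the distance of [|x|] to [d] is at most
     [E 0 / K + 1]. *)
  exists (E 0 + E 0 / K + d + 1); first lra.
  move=> t t0; have Et := bond_energy_noninc (lexx 0) t0.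
  have [h1 h2] := bond_energy_ge t; split.
    by have := norm_le_sqr (le_trans h2 Et); lra.
  have := le_trans h1 Et; rewrite mulrC -ler_pdivlMr// => /norm_le_sqr.
  by have := ler_norm (`|x t| - d); lra.
have [L L0 LE] : exists2 L : R, 0 < L & L = K * d + k * M + K * M.
  by exists (K * d + k * M + K * M) => //; rewrite !addr_gt0// mulr_gt0.
exists L => // s t s0 st; have [_ acv] := bond_sol_abs_cont sol s0 st.
have vb u : s < u -> u < t -> ~ N u -> exists2 b : R, `|b| <= L & is_derive u 1 v b.
  move=> su ut Nu; have u0 : 0 < u by lra.
  have [D [_ dv Db _]] := ode u u0 Nu; exists D => //.
  have [vM xM] := HM u (ltW u0).
  have -> : D = (D + k * v u + K * x u) - k * v u - K * x u by ring.
  have a1 : `|k * v u| <= k * M by rewrite normrM gtr0_norm// ler_pM2l.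
  have a2 : `|K * x u| <= K * M by rewrite normrM gtr0_norm// ler_pM2l.
  have := ler_normB (D + k * v u + K * x u - k * v u) (K * x u).
  have := ler_normB (D + k * v u + K * x u) (k * v u).
  lra.
have g1 : - L * (t - s) <= v t - v s.
  apply: (abs_cont_growth st acv nN) => u su ut Nu; have [D DL dv] := vb u su ut Nu.
  by exists D => //; move: DL; rewrite ler_norml => /andP[].
have g2 : - L * (t - s) <= -1 * v t - -1 * v s.
  apply: (abs_cont_growth st (abs_contZ (-1) acv) nN) => u su ut Nu.
  have [D DL dv] := vb u su ut Nu; exists (-1 * D); last exact: deriveZ_fun.
  by move: DL; rewrite ler_norml => /andP[? ?]; lra.
by rewrite ler_norml; apply/andP; split; lra.
Qed.

Lemma energy_limit : exists E8 : R, (forall t, 0 <= t -> E8 <= E t) /\ 0 <= E8 /\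
  forall e : R, 0 < e -> exists T : R, 0 <= T /\ forall t, T <= t -> E t < E8 + e.
Proof.
have [k0 K0 d0] := And3 k_gt0 K_gt0 d_gt0.
pose A := [set E t | t in [set t : R | 0 <= t]].
have A0 : A !=set0 by exists (E 0), 0 => //=.
have lA : lbound A 0.
  move=> _ [t t0 <-]; have [_ h] := bond_energy_ge t; apply: le_trans h.
  by rewrite -expr2 sqr_ge0.
have iA : has_inf A by split => //; exists 0.
exists (inf A); split.
  by move=> t t0; apply: ge_inf; [exists 0|exists t].
split; first exact: lb_le_inf.
move=> e e0; have [_ [T T0 <-] HT] := inf_adherent e0 iA.
exists T; split => // t Tt; apply: le_lt_trans HT; exact: bond_energy_noninc.
Qed.

(* Barbalat: each time [|v| >= e], the Lipschitz bound keeps [|v| >= e/2] long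
   enough to dissipate a fixed amount of energy. *)
Lemma velocity_cvg0 (e : R) : 0 < e -> exists T : R, 0 <= T /\ forall t, T <= t -> `|v t| < e.
Proof.
move=> e0; have [k0 K0 d0] := And3 k_gt0 K_gt0 d_gt0.
have [L L0 lip] := velocity_lipschitz.
have [E8 [E8le [_ E8lt]]] := energy_limit.
have [h h0 hL] : exists2 h : R, 0 < h & L * h = e / 2.
  by exists (e / 2 / L); [rewrite !divr_gt0|field; rewrite gt_eqF].
(* This is the energy lost during a time [h] with [|v| >= e / 2]; after [T] the energy exceeds its
   limit by less than that. *)
have dl0 : 0 < 2 * k * (e / 2) ^+ 2 * h by rewrite !mulr_gt0// ?exprn_gt0// divr_gt0.
have [T [T0 HT]] := E8lt _ dl0.
exists T; split => // t Tt; rewrite ltNge; apply/negP => vt.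
have t0 : 0 <= t by lra.
have th : t <= t + h by lra.
have vs s : t <= s -> s <= t + h -> e / 2 <= `|v s|.
  move=> ts sh; have := lip t s t0 ts.
  have : L * (s - t) <= L * h by rewrite ler_pM2l//; lra.
  by have := lerB_normD (v t) (v s - v t); rewrite subrKC; lra.
have e2 : 0 <= e / 2 by lra.
have := bond_energy_decay k0 sol t0 th xv_neq0 e2 vs.
have -> : t + h - t = h by ring.
by have := E8le (t + h) ltac:(lra); have := HT t Tt; lra.
Qed.

(** With [s] the sign of [v t1], real induction preserves [0 <= s x] and [|v t1| <= s v]: on side
    [s] the derivative of [s v] is [K (d - s x) - k s v >= K r - K r = 0]. *)
Lemma exit_side_invariant (t1 r : R) : 0 <= t1 -> x t1 = 0 ->
  (forall t, t1 <= t -> `|x t| <= d - r) -> (forall t, t1 <= t -> k * `|v t| <= K * r) ->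
  forall t, t1 <= t -> `|v t1| <= `|v t|.
Proof.
move=> t10 x1 xr vr; have [k0 K0 d0] := And3 k_gt0 K_gt0 d_gt0.
have [cx cv _ _] := sol.
have v1 : v t1 != 0 by have := xv_neq0 t10; rewrite xpair_eqE x1 eqxx.
have [s sE] : exists s, s = Num.sg (v t1) by exists (Num.sg (v t1)).
have s1 : s = 1 \/ s = -1.
  by rewrite sE; case: sgrP v1 => //; [left|right].
have vn : `|v t1| = s * v t1 by rewrite sE normrEsg.
have vn0 : 0 < `|v t1| by rewrite normr_gt0.
suff H : forall t, t1 <= t -> 0 <= s * x t /\ `|v t1| <= s * v t.
  by move=> t tt; have [_ /le_trans] := H t tt; apply; exact: ler_sign_norm.
have cs (f : R -> R) : continuous f -> continuous (fun t => - (s * f t)).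
  by move=> cf t; apply: (@cvgN _ R^o); apply: cvgM; [exact: cvg_cst|exact: cf].
apply: real_ind => [c|c c1 [xc vc]].
  rewrite le_eqVlt => /orP[/eqP<- _|c1 IH]; first by rewrite x1 mulr0 -vn.
  split.
    rewrite -oppr_le0; apply: (continuous_le_left (cs _ cx) c1) => u uc u1.
    by rewrite oppr_le0; have [] := IH u uc u1.
  rewrite -lerN2; apply: (continuous_le_left (cs _ cv) c1) => u uc u1.
  by rewrite lerN2; have [] := IH u uc u1.
have c0 : 0 <= c by lra.
have [h h0 H] := exit_side_enter sol c0 (xv_neq0 c0).
(* On the axis the side is the sign of [v c], which is [s] because [s v c >= |v t1| > 0]. *)
have sc : exit_side (x c) (v c) = s.
  rewrite /exit_side; have [x0|x0] := eqVneq (x c) 0; apply: sgr_of_pos => //; first lra.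
  rewrite lt_neqAle xc andbT eq_sym mulf_neq0//.
  by case: s1 => ->; rewrite ?oppr_eq0 oner_eq0.
rewrite sc in H.
have [N nN ode] := bond_sol_eq sol c0 s1 H.
exists h => // u cu uh; split; first exact/ltW/H.
have [_ acv] := bond_sol_abs_cont sol c0 (ltW cu).
have : 0 * (u - c) <= s * v u - s * v c.
  apply: (abs_cont_growth (ltW cu) (abs_contZ s acv) nN) => w cw wu Nw.
  have [_ dv] := ode w cw ltac:(lra) Nw.
  exists (s * (- k * v w - K * (x w - s * d))); last exact: deriveZ_fun.
  have xw := xr w ltac:(lra); have vw := vr w ltac:(lra).
  have Kx : K * `|x w| <= K * (d - r) by rewrite ler_pM2l.
  have -> : s * (- k * v w - K * (x w - s * d)) = K * d * (s * s) - K * (s * x w) - k * (s * v w) by ring.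
  have -> : s * s = 1 by case: s1 => ->; ring.
  have : K * (s * x w) <= K * `|x w| by rewrite ler_pM2l// ler_sign_norm.
  have : k * (s * v w) <= k * `|v w| by rewrite ler_pM2l// ler_sign_norm.
  lra.
by rewrite mul0r; lra.
Qed.

Lemma bond_sol_cvg (e : R) : 0 < e -> exists T : R, forall t, T <= t -> `| `|x t| - d| < e.
Proof.
move=> e0; have [k0 K0 d0] := And3 k_gt0 K_gt0 d_gt0.
have [cx cv _ _] := sol.
have [E8 [E8le [E80 E8lt]]] := energy_limit.
move: E80; rewrite le_eqVlt => /orP[/eqP E8E|E80].
  have [T [T0 HT]] := E8lt (K * (e * e)) ltac:(by rewrite !mulr_gt0).
  exists T => t Tt; have := HT t Tt; have [+ _] := bond_energy_ge t => /le_lt_trans h /h.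
  rewrite -E8E add0r ltr_pM2l// -!expr2 => h2.
  by rewrite -(ltr_pXn2r (n := 2))// ?nnegrE ?(ltW e0)// real_normK// num_real.
exfalso.
(* The limit energy is halved: if [|x|] were within [r] of [d], the potential part would be at most
   [E8 / 2], and [|v| < m] keeps the kinetic part below [E8 / 2]. The second condition on [m] makes
   damping at most half of the restoring force [K r]. *)
have [r r0 rE] : exists2 r : R, 0 < r & 2 * K * (r * r) = E8.
  exists (Num.sqrt (E8 / (2 * K))); first by rewrite sqrtr_gt0 divr_gt0// mulr_gt0.
  rewrite -expr2 sqr_sqrtr; last by rewrite divr_ge0 ?mulr_ge0 ?(ltW K0)// ltW.
  by field; rewrite gt_eqF.
have [m m0 [m1 m2]] : exists2 m : R, 0 < m & m * m <= E8 / 2 /\ 2 * (k * m) <= K * r.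
  have a0 : 0 < Num.sqrt (E8 / 2) by rewrite sqrtr_gt0 divr_gt0.
  have b0 : 0 < K * r / (2 * k) by rewrite !(divr_gt0, mulr_gt0).
  exists (Num.min (Num.sqrt (E8 / 2)) (K * r / (2 * k))); first by rewrite lt_min a0.
  split.
    apply: (@le_trans _ _ (Num.sqrt (E8 / 2) * Num.sqrt (E8 / 2))).
      by apply: ler_pM; rewrite ?le_min ?(ltW a0) ?(ltW b0) ?ge_min ?lexx.
    by rewrite -expr2 sqr_sqrtr// divr_ge0// ltW.
  rewrite mulrA mulrC -ler_pdivlMr ?mulr_gt0// ge_min lexx orbT//.
have [T [T0 HT]] := velocity_cvg0 m0.
have vm t : T <= t -> 2 * (k * `|v t|) <= K * r.
  move=> Tt; apply: le_trans m2; rewrite ler_pM2l// ler_pM2l//; exact/ltW/HT.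
have ur t : T <= t -> r <= `| `|x t| - d|.
  move=> Tt; rewrite leNgt; apply/negP => ur.
  have ur2 : (`|x t| - d) * (`|x t| - d) <= r * r.
    rewrite -[X in X <= _]ger0_norm; last by rewrite -expr2 sqr_ge0.
    by rewrite normrM; apply: ler_pM => //; exact: ltW.
  have vm2 : v t * v t < m * m.
    rewrite -[X in X < _]ger0_norm; last by rewrite -expr2 sqr_ge0.
    by rewrite normrM; apply: ltr_pM => //; exact: HT.
  have Kr : K * ((`|x t| - d) * (`|x t| - d)) <= K * (r * r) by rewrite ler_pM2l.
  by have := E8le t ltac:(lra); rewrite /bond_energy; lra.
have cu : continuous (fun t => `|x t| - d).
  move=> t; apply: (@cvgB _ R^o); last exact: cvg_cst.
  by apply: (@cvg_norm _ R^o); exact: cx.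
have u0 t : T <= t -> `|x t| - d != 0.
  by move=> Tt; rewrite -normr_gt0; apply: lt_le_trans (ur t Tt).
have [[t1 [Tt1 x1]]|nz] := pselect (exists t1, T <= t1 /\ x t1 = 0).
  (* At [t1] the quantity [|x| - d] equals [- d]; as it never vanishes after [T], it stays
     negative. *)
  have xr t : t1 <= t -> `|x t| <= d - r.
    move=> tt; have sg : Num.sg (`|x t| - d) = -1.
      rewrite (continuous_sgr cu tt); last by move=> w ? ?; apply: u0; lra.
      by rewrite x1 normr0 sub0r sgrN (gtr0_sg d0).
    by have := ur t ltac:(lra); rewrite normrEsg sg; lra.
  have vr t : t1 <= t -> k * `|v t| <= K * r.
    move=> tt; have := vm t ltac:(lra).
    have : 0 <= k * `|v t| by rewrite mulr_ge0// ltW.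
    lra.
  have inv := exit_side_invariant (le_trans T0 Tt1) x1 xr vr.
  have v1 : 0 < `|v t1|.
    by rewrite normr_gt0; have := xv_neq0 (le_trans T0 Tt1); rewrite xpair_eqE x1 eqxx.
  have [T' [T'0 HT']] := velocity_cvg0 v1.
  have := inv (Num.max t1 T') ltac:(by rewrite le_max lexx).
  by apply/negP; rewrite -ltNge; apply: HT'; rewrite le_max lexx orbT.
have x0 t : T <= t -> x t != 0.
  by move=> Tt; apply/eqP => xt; apply: nz; exists t.
have [s [s1 sE]] : exists s, (s = 1 \/ s = -1) /\ s = Num.sg (x T).
  exists (Num.sg (x T)); split => //; by case: sgrP (x0 T (lexx _)) => //; [left|right].
have [q [q1 qE]] : exists q, (q = 1 \/ q = -1) /\ q = Num.sg (`|x T| - d).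
  exists (Num.sg (`|x T| - d)); split => //; by case: sgrP (u0 T (lexx _)) => //; [left|right].
have sx t : T <= t -> `|x t| = s * x t.
  move=> Tt; rewrite normrEsg sE; congr (_ * _); apply: continuous_sgr => // w ? _; exact: x0.
have qu t : T <= t -> r <= q * (`|x t| - d).
  move=> Tt; have := ur t Tt; rewrite normrEsg qE (continuous_sgr cu Tt)// => w ? _; exact: u0.
(* An acceleration of at least [K r / 2] during time [h] changes the velocity by at least [4 m],
   whereas [|v| < m] at both ends. *)
have [h h0 hE] : exists2 h : R, 0 < h & K * r * h = 8 * m.
  exists (8 * m / (K * r)); first by rewrite divr_gt0// mulr_gt0.
  by field; rewrite !gt_eqF.
have TTh : T <= T + h by lra.
have sx0 t : T < t -> t <= T + h -> 0 < s * x t.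
  by move=> /ltW Tt _; rewrite -sx// normr_gt0 x0.
have [N nN ode] := bond_sol_eq sol T0 s1 sx0.
have [_ acv] := bond_sol_abs_cont sol T0 TTh.
have : K * r / 2 * (T + h - T) <= (- (q * s)) * v (T + h) - (- (q * s)) * v T.
  apply: (abs_cont_growth TTh (abs_contZ (- (q * s)) acv) nN) => w Tw wh Nw.
  have [_ dv] := ode w Tw ltac:(lra) Nw.
  exists (- (q * s) * (- k * v w - K * (x w - s * d))); last exact: deriveZ_fun.
  have -> : - (q * s) * (- k * v w - K * (x w - s * d)) =
     k * (q * s * v w) + K * (q * (s * x w - s * s * d)) by ring.
  have -> : s * s = 1 by case: s1 => ->; ring.
  rewrite mul1r -sx ?(ltW Tw)//.
  have : K * r <= K * (q * (`|x w| - d)) by rewrite ler_pM2l// qu// ltW.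
  have := vm w (ltW Tw).
  have : - `|v w| <= q * s * v w.
    rewrite lerNl -mulNr; apply: ler_sign_norm.
    by case: q1 => ->; case: s1 => ->; [right|left|left|right]; ring.
  by rewrite -(ler_pM2l k0); lra.
have n1 y : `|(- (q * s)) * y| = `|y|.
  by rewrite normrM normrN normrM; case: q1 => ->; case: s1 => ->; rewrite ?normrN normr1 ?mul1r.
have := ler_normB (- (q * s) * v (T + h)) (- (q * s) * v T).
have := ler_norm (- (q * s) * v (T + h) - - (q * s) * v T).
rewrite !n1; have := HT T (lexx _); have := HT (T + h) TTh.
lra.
Qed.

End convergence.

(** * Existence *)

Section flow.
Variable R : realType.
Implicit Types (f g : R -> R).

Lemma derive_comp_affine f (a b t D : R) : is_derive (a * t + b) 1 f D ->
  is_derive t 1 (fun s => f (a * s + b)) (a * D).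
Proof.
move=> fD; have dg : is_derive t 1 (fun s => a * s + b) a.
  apply: (is_derive_eq (deriveD_fun (deriveZ_fun a (derive_id_fun t)) (derive_cst_fun b t))); ring.
rewrite mulrC; exact: (@is_derive1_comp R f (fun s => a * s + b) t D a fD dg).
Qed.

Lemma derive_continuous f (df : R -> R) : (forall t : R, is_derive t 1 f (df t)) -> continuous f.
Proof.
move=> fd t; apply: differentiable_continuous; apply/derivable1_diffP.
by have [] := fd t.
Qed.

Lemma derive_MVT f (df : R -> R) (a b : R) : (forall t : R, is_derive t 1 f (df t)) -> a < b ->
  exists c, [/\ a < c, c < b & f b - f a = df c * (b - a)].
Proof.
move=> fd ab; have [|c] := @MVT R f df a b ab (fun x _ => fd x) _.
  by apply: continuous_subspaceT; exact: derive_continuous fd.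
by rewrite in_itv/= => /andP[ac cb] E; exists c.
Qed.

Lemma derive_abs_cont f (df : R -> R) (a b : R) : (forall t : R, is_derive t 1 f (df t)) ->
  continuous df -> abs_cont_on f a b.
Proof.
move=> fd cdf; have [M HM] := continuous_bounded a b cdf.
apply: (abs_cont_lip (L := M)) => s t as_; rewrite le_eqVlt => /orP[/eqP<-|st] tb.
  by rewrite !subrr normr0 mulr0.
have [c [sc ct ->]] := derive_MVT fd st.
have ts0 : 0 < t - s by lra.
by rewrite normrM (gtr0_norm ts0) ler_pM2r//; apply: HM; lra.
Qed.

(** Depending on the sign of [D], these are rescaled [cosh] and [sinh], [cos] and [sin], or [1] and
    [t]; the overdamped, underdamped and critical cases are then treated together. *)
Lemma hyperbolic_pair (D : R) : exists c s : R -> R,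
  [/\ forall t : R, is_derive t 1 c (D * s t), forall t : R, is_derive t 1 s (c t), c 0 = 1 & s 0 = 0].
Proof.
have [D0|D0|->] := ltrgtP D 0; last first.
- exists (fun=> 1), (fun t => t); split => // t; last exact: derive_id_fun.
  by rewrite mul0r; exact: derive_cst_fun.
- have [w w0 wE] : exists2 w : R, 0 < w & w * w = D.
    by exists (Num.sqrt D); [rewrite sqrtr_gt0|rewrite -expr2 sqr_sqrtr// ltW].
  have wn0 : w != 0 by rewrite gt_eqF.
  have dp (a t : R) : is_derive t 1 (fun t => expR (a * t + 0)) (a * expR (a * t + 0)).
    by apply: derive_comp_affine; exact: is_derive_expR.
  exists (fun t => 1 / 2 * (expR (w * t + 0) + expR (- w * t + 0))),
    (fun t => (2 * w)^-1 * (expR (w * t + 0) + -1 * expR (- w * t + 0))); split => [t|t||].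
  + apply: (is_derive_eq (deriveZ_fun _ (deriveD_fun (dp w t) (dp (- w) t)))).
    by rewrite -wE; field.
  + apply: (is_derive_eq (deriveZ_fun _ (deriveD_fun (dp w t) (deriveZ_fun (-1) (dp (- w) t))))).
    by field.
  + by rewrite !mulr0 !addr0 expR0; field.
  + by rewrite !mulr0 !addr0 expR0; ring.
- have [w w0 wE] : exists2 w : R, 0 < w & w * w = - D.
    by exists (Num.sqrt (- D)); [rewrite sqrtr_gt0 oppr_gt0|rewrite -expr2 sqr_sqrtr// oppr_ge0 ltW].
  have wn0 : w != 0 by rewrite gt_eqF.
  exists (fun t => cos (w * t + 0)), (fun t => w^-1 * sin (w * t + 0)); split => [t|t||].
  + apply: (is_derive_eq (derive_comp_affine (is_derive_cos _))).
    have DE : D = - (w * w) by rewrite wE opprK.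
    by rewrite DE; field.
  + by apply: (is_derive_eq (deriveZ_fun _ (derive_comp_affine (is_derive_sin _)))); field.
  + by rewrite mulr0 addr0 cos0.
  + by rewrite mulr0 addr0 sin0 mulr0.
Qed.

(** The factor [exp (- k t / 2)] removes the damping and leaves [y'' = D y] with
    [D = k ^ 2 / 4 - K]. [C] and [S] are the fundamental solutions with initial data [(1, 0)] and
    [(0, 1)]. *)
Lemma damped_fundamental (k K : R) : exists C S : R -> R,
  [/\ forall t : R, is_derive t 1 C (- K * S t), forall t : R, is_derive t 1 S (C t - k * S t),
      C 0 = 1 & S 0 = 0].
Proof.
have [c [s [dc ds c0 s0]]] := hyperbolic_pair (k ^+ 2 / 4 - K).
pose e (t : R) := expR (- (k / 2) * t + 0).
have de (t : R) : is_derive t 1 e (- (k / 2) * e t).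
  by apply: derive_comp_affine; exact: is_derive_expR.
exists (fun t => e t * (c t + k / 2 * s t)), (fun t => e t * s t); split => [t|t||].
- apply: (is_derive_eq (deriveM_fun (de t) (deriveD_fun (dc t) (deriveZ_fun (k / 2) (ds t))))).
  by field.
- by apply: (is_derive_eq (deriveM_fun (de t) (ds t))); field.
- by rewrite /e !mulr0 addr0 expR0 c0 s0; ring.
- by rewrite s0 mulr0.
Qed.

(* Starting from [x = 0] on side [s], the solution is
   [s x = d (1 - C) + (s v0) S] with [C < 1] and [0 < S] on a time interval that
   does not depend on [v0]; this uniformity makes solutions global. *)
Lemma half_plane_flow (k K d : R) : 0 < K -> 0 < d -> exists2 tau : R, 0 < tau &
  forall s t0 x0 v0 : R, exists x v : R -> R,
  [/\ forall t : R, is_derive t 1 x (v t),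
      forall t : R, is_derive t 1 v (- k * v t - K * (x t - s * d)),
      x t0 = x0, v t0 = v0 &
      s = 1 \/ s = -1 -> x0 = 0 -> 0 <= s * v0 ->
        forall t, t0 < t -> t <= t0 + tau -> 0 < s * x t].
Proof.
move=> K0 d0; have [C [S [dC dS C0 S0]]] := damped_fundamental k K.
have cS := derive_continuous dS; have cC := derive_continuous dC.
have cdS : continuous (fun t => C t - k * S t).
  move=> t; apply: (@cvgB _ R^o); first exact: cC.
  by apply: cvgM; [exact: cvg_cst|exact: cS].
(* [C - k S] is the derivative of [S] and equals 1 at 0, so it is positive within [h] of 0. *)
have [h h0 Hh] := @continuous_dist R _ 0 1 cdS ltr01.
have Spos t : 0 < t -> t < h -> 0 < S t.
  move=> t0 th; have [c [c0 ct]] := derive_MVT dS t0.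
  rewrite S0 !subr0 => ->; rewrite mulr_gt0//.
  have := Hh c; rewrite S0 C0 mulr0 !subr0 => /(_ ltac:(rewrite gtr0_norm//; lra)).
  by rewrite ltr_norml => /andP[? ?]; lra.
have Clt t : 0 < t -> t < h -> C t < 1.
  move=> t0 th; have [c [c0 ct]] := derive_MVT dC t0.
  rewrite C0 subr0 => E.
  have : 0 < K * S c * t by rewrite !mulr_gt0// Spos//; lra.
  by lra.
exists (h / 2); first by rewrite divr_gt0.
move=> s t0 x0 v0.
have dC' (t : R) : is_derive t 1 (fun t => C (1 * t + - t0)) (- K * S (1 * t + - t0)).
  by apply: (is_derive_eq (derive_comp_affine (dC _))); rewrite mul1r.
have dS' (t : R) : is_derive t 1 (fun t => S (1 * t + - t0)) (C (1 * t + - t0) - k * S (1 * t + - t0)).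
  by apply: (is_derive_eq (derive_comp_affine (dS _))); rewrite mul1r.
exists (fun t => s * d + ((x0 - s * d) * C (1 * t + - t0) + v0 * S (1 * t + - t0))),
  (fun t => (x0 - s * d) * - K * S (1 * t + - t0) + v0 * (C (1 * t + - t0) + - k * S (1 * t + - t0))); split.
- move=> t; apply: (is_derive_eq (deriveD_fun (derive_cst_fun (s * d) t)
    (deriveD_fun (deriveZ_fun _ (dC' t)) (deriveZ_fun _ (dS' t))))).
  by ring.
- move=> t; apply: (is_derive_eq (deriveD_fun (deriveZ_fun _ (dS' t))
    (deriveZ_fun _ (deriveD_fun (dC' t) (deriveZ_fun _ (dS' t)))))).
  by ring.
- by rewrite mul1r subrr C0 S0; ring.
- by rewrite mul1r subrr C0 S0; ring.
- move=> s1 -> sv t tt th.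
  have u0 : 0 < 1 * t + - t0 by lra.
  have uh : 1 * t + - t0 < h by lra.
  have := Spos _ u0 uh; have := Clt _ u0 uh.
  move: (1 * t + - t0) u0 uh => u u0 uh Cu Su.
  have -> : s * (s * d + ((0 - s * d) * C u + v0 * S u)) = (s * s) * (d * (1 - C u)) + (s * v0) * S u by ring.
  have -> : s * s = 1 by case: s1 => ->; ring.
  rewrite mul1r; apply: ltr_wpDr; first by apply: mulr_ge0 => //; exact: ltW.
  by apply: mulr_gt0 => //; lra.
Qed.

Lemma first_zero f (a t : R) : continuous f -> 0 < f a -> a <= t -> f t <= 0 ->
  exists c, [/\ a < c, c <= t, f c = 0 & forall u, a <= u -> u < c -> 0 < f u].
Proof.
move=> cf fa at_ ft.
pose B := [set u | a <= u /\ f u <= 0].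
have Bt : B t by [].
have lB : lbound B a by move=> u [].
have iB : has_inf B by split; [exists t|exists a].
have ac : a <= inf B by apply: lb_le_inf => //; exists t.
have below u : a <= u -> u < inf B -> 0 < f u.
  move=> au uB; rewrite ltNge; apply/negP => fu.
  by move: uB; rewrite ltNge => /negP; apply; apply: ge_inf; [exists a|split].
have fc : f (inf B) <= 0.
  rewrite leNgt; apply/negP => fc0.
  have [h h0 Hh] := continuous_dist (inf B) cf fc0.
  have [u [au fu] uh] := inf_adherent h0 iB.
  have Bu : inf B <= u by apply: ge_inf; [exists a|split].
  have := Hh u; rewrite ger0_norm ?subr_ge0// => /(_ ltac:(lra)).
  by rewrite ltr_norml => /andP[? ?]; lra.
have ac' : a < inf B.
  by rewrite lt_neqAle ac andbT; apply/eqP => E; move: fc; rewrite -E leNgt fa.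
exists (inf B); split => //.
  by apply: ge_inf; [exists a|split].
apply/eqP; rewrite eq_le fc/= -oppr_le0.
apply: (continuous_le_left (f := fun u => - f u) _ ac') => [u|u au uB].
  by apply: (@cvgN _ R^o); exact: cf.
by rewrite oppr_le0 ltW// below.
Qed.

End flow.

(** * Filippov solutions on intervals: gluing and extension *)

Section sol_on.
Variables (R : realType) (Z : R * R -> R * R).
Implicit Types (a b c : R) (z w : R -> R * R).

(** Derivatives are required only inside the interval, since the endpoints are where pieces get
    glued. *)
Definition sol_on a b z :=
  (abs_cont_on (fun t => (z t).1) a b /\ abs_cont_on (fun t => (z t).2) a b) /\
  exists2 N, (@lebesgue_measure R).-negligible N & forall t : R, a < t -> t < b -> ~ N t ->
    exists p q, [/\ is_derive t 1 (fun s => (z s).1) p, is_derive t 1 (fun s => (z s).2) q &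
      filippov_map Z (z t) (p, q)].

Lemma eq_sol_on z w a b : (forall t, a <= t -> t <= b -> z t = w t) ->
  sol_on a b z -> sol_on a b w.
Proof.
move=> zw [[ac1 ac2] [N nN ode]]; split.
  split; [apply: eq_abs_cont ac1|apply: eq_abs_cont ac2] => t ta tb; by rewrite zw.
exists N => // t ta tb Nt; have [p [q [d1 d2 F]]] := ode t ta tb Nt.
exists p, q; split.
- by apply: (is_derive_eq_itv ta tb _ d1) => s sa sb; rewrite zw// ltW.
- by apply: (is_derive_eq_itv ta tb _ d2) => s sa sb; rewrite zw// ltW.
- by rewrite -zw// ltW.
Qed.

Lemma sol_onS z a b a' b' : a <= a' -> b' <= b -> sol_on a b z -> sol_on a' b' z.
Proof.
move=> aa bb [[ac1 ac2] [N nN ode]]; split.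
  by split; [apply: abs_contS ac1|apply: abs_contS ac2].
by exists N => // t ta tb Nt; apply: ode => //; lra.
Qed.

Lemma sol_on_cat z a b c : a <= b -> b <= c -> sol_on a b z -> sol_on b c z -> sol_on a c z.
Proof.
move=> ab bc [[ac1 ac2] [N nN ode]] [[ac1' ac2'] [N' nN' ode']]; split.
  by split; [exact: abs_cont_cat ac1 ac1'|exact: abs_cont_cat ac2 ac2'].
(* The glued trajectory may have a corner at [b], which therefore becomes exceptional. *)
exists (N `|` N' `|` [set b]).
  by do ?apply: negligibleU => //; exact: negligible_set1.
move=> t ta tc /not_orP[/not_orP[Nt N't] /eqP tb].
have [tb'|bt|E] := ltrgtP t b; [exact: ode|exact: ode'|].
by rewrite E eqxx in tb.
Qed.

Lemma sol_on_glue z w a b c : a <= b -> b <= c -> z b = w b -> sol_on a b z -> sol_on b c w ->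
  sol_on a c (fun t => if t <= b then z t else w t).
Proof.
move=> ab bc zw sz sw; apply: (sol_on_cat ab bc).
  by apply: eq_sol_on sz => t _ tb; rewrite tb.
apply: eq_sol_on sw => t bt _; case: ifP => // tb.
by have -> : t = b by apply/eqP; rewrite eq_le tb bt.
Qed.

Lemma filippov_sol_on z a b : filippov_sol Z z -> 0 <= a -> a <= b -> sol_on a b z.
Proof.
move=> [ac [N [nN ode]]] a0 ab; apply: (@sol_onS z 0 b) => //; split.
  by apply: ac; lra.
exists N => // t t0 tb Nt; have [d1 [d2 F]] := ode t (ltW t0) Nt.
exists (derive1 (fun s => (z s).1) t), (derive1 (fun s => (z s).2) t); split; last exact: F.
  by apply: DeriveDef; [exact: d1|rewrite derive1E].
by apply: DeriveDef; [exact: d2|rewrite derive1E].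
Qed.

(** Each [[0, n]] has its own exceptional set, and a countable union of null sets is null. *)
Lemma sol_on_filippov z : (forall T, 0 <= T -> sol_on 0 T z) -> filippov_sol Z z.
Proof.
move=> sol; split; first by move=> T /sol[].
have /choice[N HN] : forall n : nat, exists N : set R, (@lebesgue_measure R).-negligible N /\
   forall t : R, 0 < t -> t < n%:R -> ~ N t ->
    exists p q, [/\ is_derive t 1 (fun s => (z s).1) p, is_derive t 1 (fun s => (z s).2) q &
      filippov_map Z (z t) (p, q)].
  by move=> n; have [_ [N nN ode]] := sol n%:R (ler0n _ _); exists N.
exists (\bigcup_n N n `|` [set 0]); split.
  apply: negligibleU; last exact: negligible_set1.
  by apply: negligible_bigcup => n; have [] := HN n.
move=> t; rewrite le_eqVlt => /orP[/eqP<- /not_orP[_ []]//|t0 /not_orP[Nt _]].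
have [_ ode] := HN (Num.bound t).
have [p [q [d1 d2 F]]] := ode t t0 (archi_boundP (ltW t0)) (fun h => Nt (ex_intro2 _ _ _ I h)).
have [dv1 e1] := d1; have [dv2 e2] := d2.
split; first exact: dv1.
split; first exact: dv2.
by rewrite !derive1E e1 e2.
Qed.

(** Because the step [tau] does not depend on the state, [n] chosen pieces reach time [t0 + n tau].
    [W n] follows the first [n] pieces, and the global solution at [t] uses any [W n] whose range
    covers [t]. *)
Lemma uniform_step_global (tau : R) : 0 < tau ->
  (forall t0 p, exists z, sol_on t0 (t0 + tau) z /\ z t0 = p) ->
  forall t0 p, exists z, z t0 = p /\ forall T, t0 <= T -> sol_on t0 T z.
Proof.
move=> tau0 step t0 p.
have /choice[Phi HPhi] : forall u : R * (R * R), exists z, sol_on u.1 (u.1 + tau) z /\ z u.1 = u.2.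
  by move=> [s q]; exact: step.
pose tm (n : nat) := t0 + n%:R * tau.
pose W := fix W n t := if n is n'.+1 then
  (if t <= tm n' then W n' t else Phi (tm n', W n' (tm n')) t) else p.
have tmS n : tm n.+1 = tm n + tau by rewrite /tm -natr1; ring.
have tm_ge n : t0 <= tm n by rewrite lerDl mulr_ge0// ltW.
have sW n : sol_on t0 (tm n) (W n) /\ W n t0 = p.
  elim: n => [|n [IH Wp]].
    split => //; have -> : tm 0%N = t0 by rewrite /tm mul0r addr0.
    split; first by split; exact: abs_cont_cst.
    by exists set0; [exact: negligible_set0|move=> t ? ?; exfalso; lra].
  have [s1 s2] := HPhi (tm n, W n (tm n)); rewrite /= in s1 s2.
  split; last by rewrite /= tm_ge.
  rewrite tmS; apply: sol_on_glue => //; rewrite lerDl ltW//.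
have agree n m t : t <= tm n -> W (n + m)%N t = W n t.
  move=> tn; elim: m => [|m IH]; first by rewrite addn0.
  have le : tm n <= tm (n + m) by rewrite lerD2l ler_pM2r// ler_nat leq_addr.
  by rewrite addnS /= (le_trans tn le).
pose b t := Num.bound (`|t - t0| / tau).
have tb t : t <= tm (b t).
  have : `|t - t0| / tau < (b t)%:R by rewrite archi_boundP// divr_ge0// ltW.
  rewrite ltr_pdivrMr// => h; have := ler_norm (t - t0).
  by rewrite /tm; move: h; set X := _ * tau; lra.
have zW n t : t <= tm n -> W (b t) t = W n t.
  move=> tn; have [nb|bn] := leqP n (b t).
    by rewrite -(subnKC nb) agree.
  by rewrite -(subnKC (ltnW bn)) agree.
exists (fun t => W (b t) t); split; first by have [_] := sW (b t0).
move=> T T0; have [s _] := sW (b T).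
apply: (@sol_onS _ t0 (tm (b T)) _ _ (lexx _) (tb T)).
by apply: eq_sol_on s => t _ tT; rewrite (zW (b T)).
Qed.

End sol_on.

(** * Global existence, and solutions waiting at the origin *)

Section existence.
Variables (R : realType) (k0 k1 k2 d : R) (Z0 : R -> R * R).
Hypotheses (k0_gt0 : 0 < k0) (k1_gt0 : 0 < k1) (k2_gt0 : 0 < k2) (d_gt0 : 0 < d).
Local Notation k := (k0 + k1).
Local Notation Z := (csb_field k0 k1 k2 d Z0).

Lemma flow_sol_on (x v : R -> R) (s a b : R) : s = 1 \/ s = -1 ->
  (forall t : R, is_derive t 1 x (v t)) ->
  (forall t : R, is_derive t 1 v (- k * v t - k2 * (x t - s * d))) ->
  (forall t : R, a < t -> t < b -> 0 < s * x t) -> sol_on Z a b (fun t => (x t, v t)).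
Proof.
move=> s1 dx dv sx; have cx := derive_continuous dx; have cv := derive_continuous dv.
split.
  split; first exact: derive_abs_cont dx cv.
  apply: derive_abs_cont dv _ => t; apply: (@cvgB _ R^o); apply: cvgM; try exact: cvg_cst.
    exact: cv.
  by apply: (@cvgB _ R^o); [exact: cx|exact: cvg_cst].
exists set0; first exact: negligible_set0.
move=> t ta tb _; exists (v t), (- k * v t - k2 * (x t - s * d)); split; [exact: dx|exact: dv|].
have sxt := sx t ta tb.
have x0 : (x t, v t).1 != 0 by apply/eqP => /= E; move: sxt; rewrite E mulr0 ltxx.
rewrite (csb_filippov_off d Z0 k0_gt0 k1_gt0 k2_gt0 erefl x0).
rewrite (csb_fieldE k2 d Z0 erefl x0)/=; congr (_, _).
by rewrite (sgr_of_pos s1 sxt); ring.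
Qed.

(** Off the axis, the half-plane flow is followed up to its first zero [c], if any, and a piece
    starting on the axis at [c] lasts until [c + tau], beyond [t0 + tau]. The second part lets a
    solution leave the origin to the right. *)
Lemma local_existence : exists2 tau : R, 0 < tau &
  (forall t0 p, exists z, sol_on Z t0 (t0 + tau) z /\ z t0 = p) /\
  (forall t0, exists z, [/\ sol_on Z t0 (t0 + tau) z, z t0 = (0, 0) &
     forall t, t0 < t -> t <= t0 + tau -> 0 < (z t).1]).
Proof.
have [tau tau0 flow] := half_plane_flow k k2_gt0 d_gt0; exists tau => //.
have axis t0 v0 : exists z, sol_on Z t0 (t0 + tau) z /\ z t0 = (0, v0).
  (* The side is that of the velocity; for [v0 = 0] either would do, and the right one is taken. *)
  have [s s1 sv] : exists2 s : R, s = 1 \/ s = -1 & 0 <= s * v0.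
    have [h|h] := leP 0 v0; first by exists 1; [left|rewrite mul1r].
    by exists (-1); [right|rewrite mulN1r oppr_ge0 ltW].
  have [x [v [dx dv xE vE H]]] := flow s t0 0 v0.
  exists (fun t => (x t, v t)); rewrite xE vE; split => //.
  by apply: (flow_sol_on s1 dx dv) => t ta tb; apply: H => //; exact: ltW.
split; last first.
  move=> t0; have [x [v [dx dv xE vE H]]] := flow 1 t0 0 0.
  have H' := H (or_introl erefl) erefl; rewrite mul1r in H'.
  exists (fun t => (x t, v t)); rewrite xE vE; split => //.
    by apply: (flow_sol_on (or_introl erefl) dx dv) => t ta tb; apply: H' => //; exact: ltW.
  by move=> t ta tb /=; have := H' (lexx _) t ta tb; rewrite mul1r.
move=> t0 [x0 v0]; have [->|x00] := eqVneq x0 0; first exact: axis.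
have [s sE] : exists s, s = Num.sg x0 by exists (Num.sg x0).
have s1 : s = 1 \/ s = -1 by rewrite sE; case: sgrP x00 => //; [left|right].
have sx0 : 0 < s * x0 by rewrite sE -normrEsg normr_gt0.
have [x [v [dx dv xE vE _]]] := flow s t0 x0 v0.
have [[t [tt tT xt]]|nz] := pselect (exists t, [/\ t0 <= t, t <= t0 + tau & s * x t <= 0]); last first.
  exists (fun t => (x t, v t)); rewrite xE vE; split => //.
  apply: (flow_sol_on s1 dx dv) => t ta tb; rewrite ltNge; apply/negP => xt.
  by apply: nz; exists t; split => //; exact: ltW.
have cs : continuous (fun t => s * x t).
  by move=> u; apply: cvgM; [exact: cvg_cst|exact: derive_continuous dx u].
have sxt0 : 0 < s * x t0 by rewrite xE.
have [c [tc ct xc Hc]] := first_zero cs sxt0 tt xt.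
have xc0 : x c = 0.
  by move/eqP: xc; rewrite mulf_eq0 => /orP[|/eqP//]; case: s1 => ->; rewrite ?oppr_eq0 oner_eq0.
have [z [sz zc]] := axis c (v c).
exists (fun t => if t <= c then (x t, v t) else z t); split; last by rewrite ltW// xE vE.
apply: (@sol_onS _ _ _ t0 (c + tau)) => //; first by lra.
apply: sol_on_glue => //; [exact: ltW|by lra|by rewrite zc xc0|].
by apply: (flow_sol_on s1 dx dv) => u ta tb; apply: Hc => //; exact: ltW.
Qed.

Lemma global_existence t0 p : exists z, z t0 = p /\ forall T, t0 <= T -> sol_on Z t0 T z.
Proof.
have [tau tau0 [step _]] := local_existence.
exact: uniform_step_global tau0 step t0 p.
Qed.

Lemma departure : exists2 tau : R, 0 < tau & forall t0, exists z,
  [/\ z t0 = (0, 0), forall T, t0 <= T -> sol_on Z t0 T z &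
      forall t, t0 < t -> t <= t0 + tau -> 0 < (z t).1].
Proof.
have [tau tau0 [_ step]] := local_existence; exists tau => // t0.
have [z [sz z0 zpos]] := step t0.
have [w [w0 sw]] := global_existence (t0 + tau) (z (t0 + tau)).
exists (fun t => if t <= t0 + tau then z t else w t); split.
- by rewrite lerDl (ltW tau0).
- move=> T T0; apply: (@sol_onS _ _ _ t0 (t0 + tau + (T - t0))) => //; first by lra.
  by apply: sol_on_glue => //; [lra|lra|apply: sw; lra].
- by move=> t ta tb; rewrite tb; exact: zpos.
Qed.

(** [W n] follows [z] until [ts], rests at the origin for a time [n tau], which
    [csb_filippov_origin] allows, and then departs to the right. *)
Lemma waiting_solutions (z : R -> R * R) (ts : R) : filippov_sol Z z -> 0 <= ts -> z ts = (0, 0) ->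
  exists W : nat -> R -> R * R,
    (forall n, filippov_sol Z (W n) /\ W n 0 = z 0) /\
    forall m n, (m < n)%N -> exists2 t, 0 <= t & W m t <> W n t.
Proof.
move=> sz ts0 zts; have [tau tau0 dep] := departure.
have /choice[Y HY] : forall n : nat, exists y : R -> R * R,
  [/\ y (ts + n%:R * tau) = (0, 0),
      forall T, ts + n%:R * tau <= T -> sol_on Z (ts + n%:R * tau) T y &
      forall t, ts + n%:R * tau < t -> t <= ts + n%:R * tau + tau -> 0 < (y t).1].
  by move=> n; exact: dep.
have tn n : ts <= ts + n%:R * tau by rewrite lerDl mulr_ge0// ltW.
exists (fun n t => if t <= ts + n%:R * tau then (if t <= ts then z t else (0, 0)) else Y n t).
split => [n|m n mn].
  have [Y0 sY _] := HY n; split; last by rewrite (le_trans ts0 (tn n)) ts0.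
  apply: sol_on_filippov => T T0.
  apply: (@sol_onS _ _ _ 0 (ts + n%:R * tau + T)) => //.
    by rewrite lerDr (le_trans ts0 (tn n)).
  apply: sol_on_glue.
  - exact: le_trans ts0 (tn n).
  - by rewrite lerDl.
  - by rewrite Y0; case: ifP => // h; have -> : ts + n%:R * tau = ts by apply/eqP; rewrite eq_le h tn.
  - apply: sol_on_glue => //; first exact: filippov_sol_on.
    split; first by split; exact: abs_cont_cst.
    exists set0; first exact: negligible_set0.
    move=> t ? ? _; exists 0, 0; split; try exact: derive_cst_fun.
    exact: (csb_filippov_origin (k := k0 + k1) erefl).
  - by apply: sY; rewrite lerDl.
(* At this time [W m] has left the origin and has positive position, while [W n] is still at rest
   since [m + 1 <= n]. *)
exists (ts + m%:R * tau + tau); first by rewrite addr_ge0 ?(ltW tau0)// (le_trans ts0 (tn m)).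
have lemn : ts + m%:R * tau + tau <= ts + n%:R * tau.
  by rewrite -addrA lerD2l -[X in _ + X <= _]mul1r -mulrDl ler_pM2r// natr1 ler_nat.
have [_ _ Ypos] := HY m.
rewrite lemn; case: ifP => h1; first by exfalso; lra.
case: ifP => h2; first by exfalso; have := tn m; lra.
move=> E; have := Ypos (ts + m%:R * tau + tau); rewrite E/= ltxx => H.
by have : false by apply: H; lra.
Qed.

End existence.

(** * Uniqueness, multiplicity and convergence for the planar system *)

Unset Implicit Arguments. Set Strict Implicit. Set Printing Implicit Defensive.

Theorem theorem4p3 (R : realType) (k0 k1 k2 dinf : R) (Z0 : R -> R * R)
    (x0 v0 : R) :
  0 < k0 -> 0 < k1 -> 0 < k2 -> 0 < dinf -> (x0, v0) != (0, 0) ->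
  let Z := csb_field k0 k1 k2 dinf Z0 in
  let sol := fun z : R -> R * R => filippov_sol Z z /\ z 0 = (x0, v0) in
  (* (1) unique global Filippov solution iff solutions never reach (0,0) *)
  ((exists z, sol z /\ forall w, sol w -> forall t, 0 <= t -> w t = z t) <->
   (forall z, sol z -> forall t, 0 <= t -> z t != (0, 0))) /\
  (* (1') otherwise infinitely many Filippov solutions *)
  ((exists z, sol z /\ exists t, 0 <= t /\ z t = (0, 0)) ->
   infinite_set [set f : R -> R * R | exists z, sol z /\ f = restr0 z]) /\
  (* (2) asymptotic behaviour of solutions avoiding the origin *)
  (forall z, filippov_sol Z z -> (forall t, 0 <= t -> z t != (0, 0)) ->
     (fun t => `|(z t).1|) @ +oo --> dinf).
Proof.
move=> k00 k10 k20 d0 _ Z sol.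
have k_gt0 : 0 < k0 + k1 by rewrite addr_gt0.
split; last split.
- split=> [[z [sz uz]] w [sw w0] t t0|nz].
    (* If [w] reached the origin, two distinct waiting solutions would share its initial data,
       against uniqueness. *)
    apply/eqP => wt.
    have [W [sW neqW]] := waiting_solutions k00 k10 k20 d0 sw t0 wt.
    have Wz n s : 0 <= s -> W n s = z s.
      by move=> s0; apply: uz => //; have [? W0] := sW n; split => //; rewrite W0.
    have [s s0] := neqW 0%N 1%N isT; apply.
    by rewrite !Wz.
  have [z [z0 sz]] := global_existence Z0 k00 k10 k20 d0 0 (x0, v0).
  have fz := sol_on_filippov sz.
  exists z; split => // w [fw w0] t t0.
  have bz := filippov_bond_sol k00 k10 k20 d0 fz.
  have bw := filippov_bond_sol k00 k10 k20 d0 fw.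
  have [] := bond_sol_unique k_gt0 k20 bz bw _ _ _ t0.
  + by rewrite maxxx z0 w0.
  + by rewrite maxxx z0 w0.
  + by move=> s s0; rewrite (max_r s0) -surjective_pairing; apply: nz.
  rewrite (max_r t0) => e1 e2.
  by rewrite [w t]surjective_pairing [z t]surjective_pairing e1 e2.
- move=> [z [[fz z0] [t [t0 zt]]]].
  have [W [sW neqW]] := waiting_solutions k00 k10 k20 d0 fz t0 zt.
  have WI m n : (m < n)%N -> restr0 (W m) <> restr0 (W n).
    move=> mn E; have [s s0] := neqW m n mn; apply.
    by move/(congr1 (fun f => f s)): E; rewrite /restr0 s0.
  (* Waiting solutions differ at some nonnegative time, so they stay distinct after restriction to
     [[0, oo)]. *)
  have inj : {in [set: nat] &, injective (fun n => restr0 (W n))}.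
    move=> m n _ _ E; have [mn|nm|//] := ltngtP m n.
      by case: (WI _ _ mn E).
    by case: (WI _ _ nm (esym E)).
  apply: (@sub_infinite_set _ ((fun n => restr0 (W n)) @` [set: nat])).
    by move=> _ [n _ <-]; exists (W n); split => //; have [? W0] := sW n; split => //; rewrite W0.
  by rewrite (eq_finite_set (inj_card_eq inj)); exact: infinite_nat.
- move=> z fz nz; have bz := filippov_bond_sol k00 k10 k20 d0 fz.
  have nz' s : 0 <= s -> ((z (Num.max 0 s)).1, (z (Num.max 0 s)).2) != (0, 0).
    by move=> s0; rewrite (max_r s0) -surjective_pairing; apply: nz.
  apply/cvgrPdist_lt => e e0.
  have [T HT] := bond_sol_cvg k_gt0 k20 d0 bz nz' e0.
  exists (Num.max 0 T); split; first exact: num_real.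
  move=> t; rewrite /= gt_max => /andP[t0 Tt]; rewrite distrC.
  by have := HT t (ltW Tt); rewrite (max_r (ltW t0)).
Qed.
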